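(* The problem $2$-CombDMR is solvable in polynomial time. Moreover, there is a polynomial-time algorithm which, given an $n\times n$ matrix $D$ with non-negative integer entries that is a YES-instance of $2$-CombDMR, outputs a graph realisation $(G=(V,E),\Phi)$ of $D$ with $|V|\le n+2$.
   Context: For $n\in\mathbb N$ write $[n]=\{1,\dots,n\}$. A graph realisation of an $n\times n$ matrix $D$ with non-negative integer entries is a pair $(G,\Phi)$, where $G=(V,E)$ is a finite simple undirected unweighted graph and $\Phi:[n]\to V$ is an injective map such that $d_G(\Phi(i),\Phi(j))=D_{ij}$ for all $i,j\in[n]$; here $d_G$ denotes the shortest-path distance in $G$ (equal to $\infty$ if no path exists). For a fixed $k\in\mathbb N_0$, the problem $k$-CombDMR is: given an $n\times n$ matrix $D$ with non-negative integer entries, decide whether there exists a graph realisation $(G=(V,E),\Phi)$ of $D$ with $|V|\le n+k$. *)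

(* Defs.v *)
From mathcomp Require Import all_boot.
Set Implicit Arguments. Unset Strict Implicit. Unset Printing Implicit Defensive.

Definition simple_graph (N : nat) (e : rel 'I_N) : Prop :=
  symmetric e /\ irreflexive e.

Definition walk (N : nat) (e : rel 'I_N) (u v : 'I_N) (k : nat) : Prop :=
  exists p : seq 'I_N, size p = k /\ path e u p /\ last u p = v.

(* d_G(u,v) = d (a finite number): there is a walk of length d, and none
   shorter.  (Shortest walks are shortest paths.)  d_G(u,v) = oo iff no walk
   exists, so a finite entry D_ij forces the corresponding pair to be
   connected. *)
Definition graph_dist_is (N : nat) (e : rel 'I_N) (u v : 'I_N) (d : nat) : Prop :=
  walk e u v d /\ forall k, k < d -> ~ walk e u v k.

Definition realisation (n : nat) (D : 'I_n -> 'I_n -> nat)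
    (N : nat) (e : rel 'I_N) (Phi : 'I_n -> 'I_N) : Prop :=
  simple_graph e /\ injective Phi /\
  forall i j : 'I_n, graph_dist_is e (Phi i) (Phi j) (D i j).

Definition CombDMR (k n : nat) (D : 'I_n -> 'I_n -> nat) : Prop :=
  exists (N : nat) (e : rel 'I_N) (Phi : 'I_n -> 'I_N),
    realisation D e Phi /\ N <= n + k.

Inductive sym := S0 | S1 | Sep.

Inductive move := MoveL | MoveR | Stay.

(* Tape alphabet: None = blank, inl s = I/O symbol, inr x = extra symbol. *)
Record TM := {
  tm_Q : finType;
  tm_X : finType;
  tm_start : tm_Q;
  tm_halt : pred tm_Q;
  tm_delta : tm_Q -> option (sym + tm_X) ->
             tm_Q * option (sym + tm_X) * move
}.

Definition tsym (M : TM) := option (sym + tm_X M).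

(* Configuration: state, cells left of the head (nearest first), head cell,
   cells right of the head (nearest first).  Cells beyond are blank. *)
Record config (M : TM) := Config {
  c_state : tm_Q M;
  c_left : seq (tsym M);
  c_head : tsym M;
  c_right : seq (tsym M)
}.

Definition do_move (M : TM) (m : move) (q : tm_Q M)
    (l : seq (tsym M)) (h : tsym M) (r : seq (tsym M)) : config M :=
  match m with
  | Stay => Config q l h r
  | MoveL => match l with
             | [::] => Config q [::] None (h :: r)
             | a :: l' => Config q l' a (h :: r)
             end
  | MoveR => match r with
             | [::] => Config q (h :: l) None [::]
             | a :: r' => Config q (h :: l) a r'
             end
  end.

Definition tm_step (M : TM) (c : config M) : config M :=
  if tm_halt (c_state c) then c else
  let: (q', w, m) := tm_delta (c_state c) (c_head c) in
  do_move m q' (c_left c) w (c_right c).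

Definition tm_init (M : TM) (x : seq sym) : config M :=
  match x with
  | [::] => Config (tm_start M) [::] None [::]
  | a :: x' => Config (tm_start M) [::] (Some (inl a)) [seq Some (inl b) | b <- x']
  end.

(* Output: the symbols from the head rightwards up to the first blank;
   undefined (None) if a non-I/O symbol occurs before that blank. *)
Fixpoint read_out (X : Type) (s : seq (option (sym + X))) : option (seq sym) :=
  match s with
  | [::] => Some [::]
  | None :: _ => Some [::]
  | Some (inl a) :: s' => omap (cons a) (read_out s')
  | Some (inr _) :: _ => None
  end.

Definition tm_result (M : TM) (x : seq sym) (t : nat) : option (seq sym) :=
  let c := iter t (@tm_step M) (tm_init M x) in
  if tm_halt (c_state c) then read_out (c_head c :: c_right c) else None.

(* Binary representation, least significant bit first, no leading zeros
   (0 is the empty word). *)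
Fixpoint bin_fuel (fuel m : nat) : seq sym :=
  match fuel with
  | 0 => [::]
  | fuel'.+1 => if m == 0 then [::]
                else (if odd m then S1 else S0) :: bin_fuel fuel' m./2
  end.
Definition bin (m : nat) : seq sym := bin_fuel m m.

Definition enc_matrix (n : nat) (D : 'I_n -> 'I_n -> nat) : seq sym :=
  flatten [seq bin (D i j) ++ [:: Sep] | i <- enum 'I_n, j <- enum 'I_n].

Definition enc_realisation (n N : nat) (e : rel 'I_N) (Phi : 'I_n -> 'I_N)
    : seq sym :=
  bin N ++ [:: Sep] ++
  [seq (if e u v then S1 else S0) | u <- enum 'I_N, v <- enum 'I_N] ++
  [:: Sep] ++ flatten [seq bin (Phi i) ++ [:: Sep] | i <- enum 'I_n].

(* Main.v *)
Require Import Defs.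
From mathcomp Require Import all_boot.
From mathcomp Require Import zify.
Set Implicit Arguments. Unset Strict Implicit. Unset Printing Implicit Defensive.

(* Adding isolated vertices, one may assume exactly two extra vertices a and b;
   two terminals are adjacent iff they are at distance 1. Call a pair of
   terminals critical if no third terminal lies on a geodesic between them. The
   inner vertices of a shortest path joining a critical pair are extra vertices,
   so its distance is at most 3, and what remains to be chosen is, for each
   terminal i, whether it is joined to a and whether it is joined to b: two
   Boolean variables a_i, b_i, while ab is an edge iff some critical pair is at
   distance 3. That no distance becomes too short forbids some pairs of
   positive literals (two neighbours of a are at distance at most 2, ...). A
   critical pair at distance 2 needs (a_i and a_j) or (b_i and b_j), one at
   distance 3 needs (a_i and b_j) or (b_i and a_j), and both are conjunctions of
   2-clauses. Thus the realisations are the models of a 2-SAT instance, which is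
   solved by assigning the variables one after the other with unit propagation.

   Entries of a YES-instance are at most n + 1, so they can be handled in unary
   once they are decoded with saturation. The Turing machine works in place on
   the input, extended by four blank cells: a cell carries finitely many bits,
   one per track; a register is a track with a single marked position, hence a
   number below the length of the tape, and a memory is an arbitrary track.
   Every elementary operation is one sweep of the tape to and fro, and all loops
   run through the positions of the tape, so the running time of a program is
   polynomial by construction. *)

(** * Operations on a multi-track tape *)

(** The edge ab needs no guessing: a critical pair at distance 3 forces it, and without such a pair
    leaving it out only removes constraints. The number 2 of extra vertices is what makes the
    clauses short: a disjunction of two conjunctions, one per extra vertex, distributes into four
    clauses of two literals.

    Saturation loses nothing. On S cells all arithmetic is capped at S - 1, and an entry that
    reaches the cap can be recognised and rejected, because a YES-instance has entries at most n + 1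
    < S - 1. A capped sum of two distances is harmless too, since the cap then exceeds every entry
    it is compared with.

    The input word does not state n; it is found by search, as the number whose square is the number
    of separators. These n * n separators and the four extra cells give n * n + 4 <= S, and this
    makes room for everything: 4 * n <= S rounds of propagation for the 4 * n literals, the number n
    + 2 of vertices below the cap, and the constant 3 even when the input is empty. *)

Definition upd (A : Type) (f : nat -> A) (x : nat) (v : A) : nat -> A :=
  fun y => if y == x then v else f y.

Lemma upd_eq (A : Type) (f : nat -> A) x v : upd f x v x = v.
Proof. by rewrite /upd eqxx. Qed.

Lemma upd_neq (A : Type) (f : nat -> A) x v y : y != x -> upd f x v y = f y.
Proof. by rewrite /upd => /negbTE->. Qed.

Record store := Store {
  reg : nat -> nat;
  ram : nat -> nat -> bool;
  out : seq sym
}.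

Definition setr (s : store) (x v : nat) : store :=
  Store (upd (reg s) x v) (ram s) (out s).

Definition setm (s : store) (m p : nat) (b : bool) : store :=
  Store (reg s) (upd (ram s) m (upd (ram s m) p b)) (out s).

Definition emit (s : store) (a : sym) : store :=
  Store (reg s) (ram s) (rcons (out s) a).

Inductive op :=
  | OZero of nat | OCopy of nat & nat | OInc of nat
  | OWr of nat & nat & bool
  | OEq of nat & nat | OLt of nat & nat | OMem of nat & nat.

Definition op_sem (S : nat) (o : op) (s : store) : store * bool :=
  match o with
  | OZero x => (setr s x 0, false)
  | OCopy x y => (setr s x (reg s y), false)
  | OInc x => (setr s x (minn S.-1 (reg s x).+1), (reg s x).+1 < S)
  | OWr m x b => (setm s m (reg s x) b, false)
  | OEq x y => (s, reg s x == reg s y)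
  | OLt x y => (s, reg s x < reg s y)
  | OMem m x => (s, ram s m (reg s x))
  end.

Definition in_range (S : nat) (s : store) : Prop := forall x, reg s x < S.

Lemma op_sem_in_range S o s : in_range S s -> in_range S (op_sem S o s).1.
Proof.
move=> sS; case: o => [x|x y|x|m x b|x y|x y|m x] //= z; rewrite /= /upd;
  case: eqP => // _; have := sS z; have := sS x; lia.
Qed.

Lemma op_sem_out S o s : out (op_sem S o s).1 = out s.
Proof. by case: o. Qed.

(* Even tracks hold the registers, as the unique marked position, and odd
   tracks the memories. *)
Definition bit (s : store) (t p : nat) : bool :=
  if odd t then ram s t./2 p else reg s t./2 == p.

Definition op_tracks (o : op) : nat :=
  match o with
  | OZero x => x.*2
  | OCopy x y | OEq x y | OLt x y => maxn x.*2 y.*2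
  | OInc x => x.*2
  | OWr m x _ | OMem m x => maxn m.*2.+1 x.*2
  end.

Section Sweep.
Variable T : nat.

Definition cell : finType := {ffun 'I_T.+1 -> bool}.

(** Past track [T], [rd] falls back on track 0 whereas [wr] changes nothing; hence reading, unlike
    writing, requires a bound on the track. *)
Definition rd (c : cell) (t : nat) : bool := c (inord t).
Definition wr (c : cell) (t : nat) (b : bool) : cell :=
  [ffun u : 'I_T.+1 => if val u == t then b else c u].

Definition cell_at (s : store) (p : nat) : cell :=
  [ffun t : 'I_T.+1 => bit s t p].

Lemma rd_reg s x p : x.*2 <= T -> rd (cell_at s p) x.*2 = (reg s x == p).
Proof. by move=> xT; rewrite /rd ffunE inordK // /bit odd_double doubleK. Qed.

Lemma rd_mem s m p : m.*2.+1 <= T -> rd (cell_at s p) m.*2.+1 = ram s m p.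
Proof. by move=> xT; rewrite /rd ffunE inordK // /bit /= odd_double /= uphalf_double. Qed.

Lemma wr_reg s x p v b : b = (v == p) ->
  wr (cell_at s p) x.*2 b = cell_at (setr s x v) p.
Proof.
move=> ->; apply/ffunP=> u; rewrite !ffunE /bit /= /upd.
case: eqP => [->|ne]; first by rewrite odd_double doubleK eqxx.
by case: ifP => // ou; case: (u./2 =P x) => // e; case: ne; rewrite -e -[LHS]odd_double_half ou.
Qed.

Lemma wr_setr s x p v v' b : b = (v' == p) ->
  wr (cell_at (setr s x v) p) x.*2 b = cell_at (setr s x v') p.
Proof.
move=> bE; rewrite (@wr_reg _ _ _ v') //; apply/ffunP=> u; rewrite !ffunE /bit /= /upd.
by case: ifP => // _; case: (u./2 =P x).
Qed.

Lemma cell_at_setr s x p v v' : (v == p) = (v' == p) ->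
  cell_at (setr s x v) p = cell_at (setr s x v') p.
Proof.
move=> vE; apply/ffunP=> u; rewrite !ffunE /bit /= /upd.
by case: ifP => // _; case: (u./2 =P x).
Qed.

Lemma wr_mem s m p b : wr (cell_at s p) m.*2.+1 b = cell_at (setm s m p b) p.
Proof.
apply/ffunP=> u; rewrite !ffunE /bit /= /upd.
case: eqP => [->|ne]; first by rewrite /= odd_double /= uphalf_double !eqxx.
by case: ifP => // ou; case: (u./2 =P m) => // e; case: ne; rewrite -e -[LHS]odd_double_half ou.
Qed.

Lemma setm_other s m p q b : p != q -> cell_at (setm s m p b) q = cell_at s q.
Proof.
move=> pq; apply/ffunP=> u; rewrite !ffunE /bit /= /upd.
by case: ifP => // ou; case: eqP => // ->; case: eqP => // e; lia.
Qed.

(** The head carries two bits, and the second one ends up as the answer of the operation. [OZero]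
    starts with a marker in hand for the first cell; [OInc] starts with the answer true, which an
    overflow revokes on the way back. *)
Definition sweep0 (o : op) : bool * bool :=
  match o with OZero _ => (true, false) | OInc _ => (false, true) | _ => (false, false) end.

(** [OInc] writes the marker one cell late: its first bit tells whether the marker stood on the
    previous cell. In [OLt] the first bit remembers that the marker of [x] has been passed. *)
Definition fwd (o : op) (q : bool * bool) (c : cell) : (bool * bool) * cell :=
  match o with
  | OZero x => ((false, q.2), wr c x.*2 q.1)
  | OCopy x y => (q, wr c x.*2 (rd c y.*2))
  | OInc x => ((rd c x.*2, q.2), wr c x.*2 q.1)
  | OWr m x b => (q, if rd c x.*2 then wr c m.*2.+1 b else c)
  | OEq x y => ((q.1, q.2 || rd c x.*2 && rd c y.*2), c)
  | OLt x y => ((q.1 || rd c x.*2, q.2 || q.1 && rd c y.*2), c)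
  | OMem m x => ((q.1, q.2 || rd c m.*2.+1 && rd c x.*2), c)
  end.

(* Only the increment needs the way back: a marker that fell off the right end
   is put back on the last cell. *)
Definition bwd (o : op) (q : bool * bool) (c : cell) : (bool * bool) * cell :=
  match o with
  | OInc x => ((false, q.2 && ~~ q.1), if q.1 then wr c x.*2 true else c)
  | _ => (q, c)
  end.

(** [qf p] and [qb p] are the bits carried across the border to the left of cell [p], on the way out
    and on the way back, and [w] is the tape in between. With these given in closed form, every
    operation is checked cell by cell, without induction. *)
Lemma sweep_correct S o s : in_range S s -> 0 < S -> op_tracks o <= T ->
  exists (w : nat -> cell) (qf qb : nat -> bool * bool),
    [/\ qf 0 = sweep0 o,
        forall p, p < S -> fwd o (qf p) (cell_at s p) = (qf p.+1, w p),
        qb S = qf S,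
        forall p, p < S ->
          bwd o (qb p.+1) (w p) = (qb p, cell_at (op_sem S o s).1 p)
      & (qb 0).2 = (op_sem S o s).2].
Proof.
move=> sS S0; case: o => [x|x y|x|m x b|x y|x y|m x] /= oT.
- exists (cell_at (setr s x 0)), (fun p => (p == 0, false)), (fun p => (S == 0, false)).
  have -> : (S == 0) = false by lia.
  by split=> //= p _; rewrite (@wr_reg _ _ _ 0) // eq_sym.
- exists (cell_at (setr s x (reg s y))), (fun p => (false, false)), (fun p => (false, false)).
  by split=> //= p _; rewrite rd_reg ?(@wr_reg _ _ _ (reg s y)) //; lia.
(* The incremented value may be [S], in which case the intermediate tape has no marker at all; the
   first bit is then still set at the right end, and the way back restores the marker on cell
   [S - 1]. *)
- exists (cell_at (setr s x (reg s x).+1)), (fun p => ((reg s x).+1 == p, true)),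
    (fun p => ((p == S) && ((reg s x).+1 == S), (p == S) || ((reg s x).+1 < S))).
  have sx := sS x.
  split=> //=; first by move=> p _; rewrite rd_reg ?(@wr_reg _ _ _ ((reg s x).+1)) // eqSS.
  + by rewrite eqxx.
  + move=> p pS.
    have -> : (p == S) = false by lia.
    congr ((_, _), _); first by case: eqP => //=; lia.
    by case: andP => h; [apply: wr_setr | apply: cell_at_setr]; lia.
  + by have -> : (0 == S) = false by lia.
- exists (cell_at (setm s m (reg s x) b)), (fun p => (false, false)), (fun p => (false, false)).
  split=> //= p _; rewrite rd_reg; last lia.
  case: eqP => [<-|xp]; first by rewrite wr_mem.
  by rewrite setm_other //; apply/eqP.
- exists (cell_at s), (fun p => (false, (reg s x == reg s y) && (reg s x < p))),
    (fun p => (false, (reg s x == reg s y) && (reg s x < S))).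
  split=> //=; first by rewrite ltn0 andbF.
  + by move=> p _; rewrite !rd_reg; try lia; congr ((_, _), _); lia.
  + by rewrite sS andbT.
- exists (cell_at s), (fun p => (reg s x < p, (reg s x < reg s y) && (reg s y < p))),
    (fun p => (reg s x < S, (reg s x < reg s y) && (reg s y < S))).
  split=> //=; first by rewrite !ltn0 andbF.
  + by move=> p _; rewrite !rd_reg; try lia; congr ((_, _), _); lia.
  + by rewrite sS andbT.
- exists (cell_at s), (fun p => (false, ram s m (reg s x) && (reg s x < p))),
    (fun p => (false, ram s m (reg s x) && (reg s x < S))).
  split=> //=; first by rewrite ltn0 andbF.
  + move=> p _; rewrite rd_reg ?rd_mem; try lia; congr ((_, _), _).
    by rewrite ltnS; case: (ltngtP (reg s x) p) => [_|_|->]; rewrite ?andbT ?andbF ?orbF.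
  + by rewrite sS andbT.
Qed.
End Sweep.

(** * The Turing machine of a list of instructions *)

Inductive instr := ISweep of op & nat & nat | IEmit of sym & nat.

(** Memory 0 marks the ones and memory 1 the separators. A zero and a blank look alike, which does
    no harm because every word is closed by a separator. *)
Definition sym_bit (m : nat) (a : option sym) : bool :=
  match m, a with
  | 0, Some S1 | 1, Some Sep => true
  | _, _ => false
  end.

Definition store0 (x : seq sym) : store :=
  Store (fun=> 0) (fun m p => sym_bit m (onth x p)) [::].

Section Machine.
Variables (T : nat) (P : seq instr).

Definition phase : finType :=
  ((bool * (bool * bool)) + ((bool * 'I_5) + 'I_5))%type.
Definition ctrl : finType := ('I_(size P).+1 * phase)%type.
Definition extra : finType := option (cell T).
Definition tape_sym := option (sym + extra).

Definition Sweep (d : bool) (q : bool * bool) : phase := inl (d, q).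
(** [b] tells whether the head is on the first cell, which carries the markers of all registers, and
    [k] counts the padding cells already written. *)
Definition Init (b : bool) (k : nat) : phase := inr (inl (b, inord k)).
Definition Ctl (k : nat) : phase := inr (inr (inord k)).
Definition Home := Ctl 0.
Definition Emitting := Ctl 1.
Definition Returning := Ctl 2.
Definition Finishing := Ctl 3.
Definition Halted := Ctl 4.

Definition at_pc (pc : nat) (ph : phase) : ctrl := (inord pc, ph).

Definition acell (c : cell T) : tape_sym := Some (inr (Some c)).
Definition fence : tape_sym := Some (inr None).
Definition osym (a : sym) : tape_sym := Some (inl a).

Definition init_cell (b : bool) (a : option sym) : cell T :=
  [ffun t : 'I_T.+1 => if odd t then sym_bit (val t)./2 a else b].

Definition delta_sweep (pc : 'I_(size P).+1) (d : bool) (q : bool * bool) (a : tape_sym)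
    : ctrl * tape_sym * move :=
  match onth P pc with
  | Some (ISweep o lt lf) =>
    match a with
    | Some (inr (Some c)) =>
      let: (q', c') := (if d then fwd o q c else bwd o q c) in
      ((pc, Sweep d q'), acell c', if d then MoveR else MoveL)
    | _ => if d then ((pc, Sweep false q), a, MoveL)
           else (at_pc (if q.2 then lt else lf) Home, a, Stay)
    end
  | _ => ((pc, Halted), a, Stay)
  end.

Definition delta_init (pc : 'I_(size P).+1) (b : bool) (k : nat) (a : tape_sym)
    : ctrl * tape_sym * move :=
  match a with
  | Some (inl s) => ((pc, Init false k), acell (init_cell b (Some s)), MoveR)
  | _ => if k < 4 then ((pc, Init false k.+1), acell (init_cell b None), MoveR)
         else ((pc, Returning), fence, MoveL)
  end.

Definition delta_ctl (pc : 'I_(size P).+1) (k : nat) (a : tape_sym)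
    : ctrl * tape_sym * move :=
  match k with
  | 0 => (pc, match onth P pc with
              | Some (ISweep o _ _) => Sweep true (sweep0 o)
              | Some (IEmit _ _) => Emitting
              | None => Finishing
              end, a, MoveR)
  | 1 => match onth P pc, a with
         | Some (IEmit s l), None => (at_pc l Returning, osym s, MoveL)
         | _, _ => ((pc, Emitting), a, MoveR)
         end
  | 2 => if a is None then ((pc, Home), a, Stay) else ((pc, Returning), a, MoveL)
  | _ => if a is Some (inr None) then ((pc, Halted), a, MoveR)
         else ((pc, Finishing), a, MoveR)
  end.

Definition delta (q : ctrl) (a : tape_sym) : ctrl * tape_sym * move :=
  match q with
  | (pc, inl (d, q)) => delta_sweep pc d q a
  | (pc, inr (inl (b, k))) => delta_init pc b k a
  | (pc, inr (inr k)) => delta_ctl pc k a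
  end.

Definition machine : TM :=
  {| tm_Q := ctrl; tm_X := extra; tm_start := at_pc 0 (Init true 0);
     tm_halt := fun q : ctrl => q.2 == Halted; tm_delta := delta |}.

Notation step := (@tm_step machine).

Definition conf (q : ctrl) (l r : seq tape_sym) : config machine :=
  match r with
  | [::] => @Config machine q l None [::]
  | a :: r' => @Config machine q l a r'
  end.

Definition steps (c : config machine) (t : nat) (c' : config machine) : Prop :=
  iter t step c = c'.

Lemma steps_trans c1 c2 c3 t1 t2 :
  steps c1 t1 c2 -> steps c2 t2 c3 -> steps c1 (t1 + t2) c3.
Proof. by rewrite /steps addnC iterD => -> ->. Qed.

Lemma steps_cons c1 c2 c3 t : step c1 = c2 -> steps c2 t c3 -> steps c1 t.+1 c3.
Proof. by rewrite /steps iterSr => ->. Qed.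

Definition cells (w : nat -> cell T) (a n : nat) : seq tape_sym :=
  [seq acell (w p) | p <- iota a n].

Definition workspace (S : nat) (s : store) : seq tape_sym :=
  cells (cell_at T s) 0 S ++ fence :: map osym (out s).

Definition home (S : nat) (pc : nat) (s : store) : config machine :=
  conf (at_pc pc Home) [::] (None :: workspace S s).

Lemma onth_at pc : pc <= size P -> onth P (inord pc : 'I_(size P).+1) = onth P pc.
Proof. by move=> pcP; rewrite inordK. Qed.

Lemma Ctl_neq_Halted k : k < 4 -> (Ctl k == Halted) = false.
Proof.
move=> k4; apply/eqP => -[] /(congr1 (@nat_of_ord _)); rewrite !inordK //; lia.
Qed.

(** [conf] and [confL] place the head to the right and to the left of the border between [l] and
    [r]; sweeps are inductions that move this border. *)
Definition confL (q : ctrl) (l r : seq tape_sym) : config machine :=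
  match l with
  | [::] => @Config machine q [::] None r
  | a :: l' => @Config machine q l' a r
  end.

Lemma do_moveR (q : ctrl) l (h : tape_sym) r :
  @do_move machine MoveR q l h r = conf q (h :: l) r.
Proof. by case: r. Qed.

Lemma do_moveL (q : ctrl) l (h : tape_sym) r :
  @do_move machine MoveL q l h r = confL q l (h :: r).
Proof. by case: l. Qed.

Section Instr.
Variables (S pc : nat).
Hypothesis pcP : pc <= size P.

Lemma step_fwd o lt lf q c q' c' l r :
  onth P pc = Some (ISweep o lt lf) -> fwd o q c = (q', c') ->
  step (conf (at_pc pc (Sweep true q)) l (acell c :: r)) =
  conf (at_pc pc (Sweep true q')) (acell c' :: l) r.
Proof.
by move=> Ppc wE; rewrite /tm_step /= /delta_sweep onth_at // Ppc /= wE do_moveR.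
Qed.

Lemma step_bwd o lt lf q c q' c' l r :
  onth P pc = Some (ISweep o lt lf) -> bwd o q c = (q', c') ->
  step (confL (at_pc pc (Sweep false q)) (acell c :: l) r) =
  confL (at_pc pc (Sweep false q')) l (acell c' :: r).
Proof.
by move=> Ppc wE; rewrite /tm_step /= /delta_sweep onth_at // Ppc /= wE do_moveL.
Qed.

Lemma fwd_steps o lt lf (w w' : nat -> cell T) (qf : nat -> bool * bool) a n l r :
  onth P pc = Some (ISweep o lt lf) ->
  (forall p, a <= p < a + n -> fwd o (qf p) (w p) = (qf p.+1, w' p)) ->
  steps (conf (at_pc pc (Sweep true (qf a))) l (cells w a n ++ r)) n
        (conf (at_pc pc (Sweep true (qf (a + n)))) (rev (cells w' a n) ++ l) r).
Proof.
move=> Ppc; elim: n a l => [|n IH] a l wE; first by rewrite addn0 /steps.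
apply: (steps_cons (step_fwd _ _ Ppc (wE a _))); first lia.
rewrite /= rev_cons cat_rcons -addSnnS; apply: IH => p ap; apply: wE; lia.
Qed.

Lemma bwd_steps o lt lf (w w' : nat -> cell T) (qb : nat -> bool * bool) n l r :
  onth P pc = Some (ISweep o lt lf) ->
  (forall p, p < n -> bwd o (qb p.+1) (w p) = (qb p, w' p)) ->
  steps (confL (at_pc pc (Sweep false (qb n))) (rev (cells w 0 n) ++ l) r) n
        (confL (at_pc pc (Sweep false (qb 0))) l (cells w' 0 n ++ r)).
Proof.
move=> Ppc; elim: n r => [|n IH] r wE; first by rewrite /steps.
rewrite /cells -addn1 iotaD !map_cat rev_cat /= -catA.
rewrite addn1; apply: (steps_cons (step_bwd _ _ Ppc (wE n _))) => //.
by apply: IH => p pn; apply: wE; lia.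
Qed.

Lemma home_step s : step (home S pc s) =
  conf (at_pc pc (match onth P pc with
                  | Some (ISweep o _ _) => Sweep true (sweep0 o)
                  | Some (IEmit _ _) => Emitting
                  | None => Finishing
                  end)) [:: None] (workspace S s).
Proof.
by rewrite /tm_step /= Ctl_neq_Halted //= inordK //= onth_at // do_moveR.
Qed.

Lemma sweep_steps o lt lf s : onth P pc = Some (ISweep o lt lf) ->
  in_range S s -> 0 < S -> op_tracks o <= T ->
  steps (home S pc s) (S.*2 + 3)
    (home S (if (op_sem S o s).2 then lt else lf) (op_sem S o s).1).
Proof.
move=> Ppc sS S0 oT.
have [w [qf [qb [qf0 fE qbS bE qb0]]]] := sweep_correct sS S0 oT.
have -> : S.*2 + 3 = (S + (S + 1).+1).+1 by rewrite -addnn; lia.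
apply: (steps_cons (home_step s)); rewrite Ppc -qf0.
apply: steps_trans (fwd_steps (w' := w) _ _ Ppc _) _; first by move=> p pS; apply: fE; lia.
rewrite add0n -qbS.
apply: (@steps_cons _ (confL (at_pc pc (Sweep false (qb S))) (rev (cells w 0 S) ++ [:: None])
         (fence :: map osym (out s)))).
  by rewrite /tm_step /= /delta_sweep onth_at // Ppc.
apply: steps_trans (bwd_steps _ _ Ppc bE) _.
rewrite /steps /= /tm_step /= /delta_sweep onth_at // Ppc /= -qb0.
by rewrite /home /workspace op_sem_out.
Qed.

Lemma emit_right a l (r : seq tape_sym) left : onth P pc = Some (IEmit a l) ->
  all isSome r ->
  steps (conf (at_pc pc Emitting) left r) (size r)
    (conf (at_pc pc Emitting) (rev r ++ left) [::]).
Proof.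
move=> Ppc; elim: r left => [|b r IH] left //= /andP[b0 r0].
apply: (@steps_cons _ (conf (at_pc pc Emitting) (b :: left) r)); last first.
  by rewrite rev_cons cat_rcons; apply: IH.
rewrite /tm_step /= Ctl_neq_Halted //= inordK //= onth_at // Ppc.
by case: b b0 => //= b _; rewrite do_moveR.
Qed.

(** Both shapes of the left end occur: after initialisation no cell exists there yet and the move to
    the left creates the blank, whereas later the blank of [home] is already present. *)
Lemma return_left (r r' left : seq tape_sym) : all isSome r ->
  left = [::] \/ left = [:: None] ->
  steps (confL (at_pc pc Returning) (rev r ++ left) r') (size r).+1
    (conf (at_pc pc Home) [::] (None :: r ++ r')).
Proof.
move=> r0 leftE; elim/last_ind: r r' r0 => [|r b IH] r'.
  by case: leftE => -> _; rewrite /steps /= /tm_step /= Ctl_neq_Halted //= inordK.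
rewrite all_rcons => /andP[b0 r0]; rewrite size_rcons rev_rcons cat_rcons.
apply: (@steps_cons _ (confL (at_pc pc Returning) (rev r ++ left) (b :: r'))); last exact: IH.
rewrite /tm_step /= Ctl_neq_Halted //= inordK //=.
by case: b b0 => //= b _; rewrite do_moveL.
Qed.

Lemma finish_right (w : nat -> cell T) a n l r :
  steps (conf (at_pc pc Finishing) l (cells w a n ++ fence :: r)) n.+1
    (conf (at_pc pc Halted) (fence :: rev (cells w a n) ++ l) r).
Proof.
elim: n a l => [|n IH] a l.
  by rewrite /steps /= /tm_step /= Ctl_neq_Halted //= inordK //= do_moveR.
apply: (@steps_cons _ (conf (at_pc pc Finishing) (acell (w a) :: l) (cells w a.+1 n ++ fence :: r))).
  by rewrite /tm_step /= Ctl_neq_Halted //= inordK //= do_moveR.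
by rewrite /= rev_cons cat_rcons; apply: IH.
Qed.
End Instr.

Lemma all_isSome_map (A : Type) (f : A -> tape_sym) r :
  (forall a, isSome (f a)) -> all isSome (map f r).
Proof. by move=> fS; elim: r => //= a r ->; rewrite fS. Qed.

Lemma workspace_isSome S s : all isSome (workspace S s).
Proof. by rewrite all_cat /= !all_isSome_map. Qed.

Lemma size_workspace S s : size (workspace S s) = (S + size (out s)).+1.
Proof. by rewrite size_cat /= !size_map size_iota addnS. Qed.

Lemma emit_steps S pc a l s : pc <= size P -> onth P pc = Some (IEmit a l) ->
  steps (home S pc s) ((S + size (out s)).*2 + 5) (home S l (emit s a)).
Proof.
move=> pcP Ppc.
have -> : (S + size (out s)).*2 + 5 = (size (workspace S s) + ((size (workspace S s)).+1).+1).+1.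
  by rewrite size_workspace -addnn; lia.
apply: (steps_cons (home_step _ pcP s)); rewrite Ppc.
apply: (steps_trans (emit_right pcP _ Ppc (workspace_isSome S s))). 
apply: (@steps_cons _ (confL (at_pc l Returning) (rev (workspace S s) ++ [:: None]) [:: osym a])).
  by rewrite /tm_step /= Ctl_neq_Halted //= inordK //= onth_at // Ppc.
have -> : home S l (emit s a) = conf (at_pc l Home) [::] (None :: workspace S s ++ [:: osym a]).
  by rewrite /home /workspace /= map_rcons -cats1 -catA.
by apply: return_left => //; [exact: workspace_isSome | right].
Qed.

(** The program ends by jumping to the address just behind its last instruction, where the absence
    of an instruction starts [Finishing]. *)
Lemma final_steps S s : exists c, steps (home S (size P) s) S.+2 c /\
  tm_halt (c_state c) /\ read_out (c_head c :: c_right c) = Some (out s).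
Proof.
exists (conf (at_pc (size P) Halted) (fence :: rev (cells (cell_at T s) 0 S) ++ [:: None])
         (map osym (out s))); split.
  apply: (steps_cons (home_step _ (leqnn _) s)); rewrite onth_default //.
  exact: finish_right.
split; first by case: (map _ _) => [|? ?] /=; rewrite eqxx.
have H (y : seq sym) : read_out (map osym y) = Some y by elim: y => //= a y ->.
by case: (out s) => //= a y; rewrite H.
Qed.

Lemma init_cellE x p : init_cell (p == 0) (onth x p) = cell_at T (store0 x) p.
Proof. by apply/ffunP=> t; rewrite !ffunE /bit /= eq_sym. Qed.

Lemma cellsS (w : nat -> cell T) p : cells w 0 p.+1 = rcons (cells w 0 p) (acell (w p)).
Proof. by rewrite /cells -addn1 iotaD map_cat cats1. Qed.

Lemma init_steps x :
  steps (tm_init machine x) ((size x).*2 + 10) (home (size x + 4) 0 (store0 x)).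
Proof.
pose w := cell_at T (store0 x).
have ini : tm_init machine x = conf (at_pc 0 (Init true 0)) [::] (map osym x) by case: x @w.
have read n p : p + n = size x ->
  steps (conf (at_pc 0 (Init (p == 0) 0)) (rev (cells w 0 p)) (map osym (drop p x))) n
    (conf (at_pc 0 (Init (size x == 0) 0)) (rev (cells w 0 (size x))) [::]).
  elim: n p => [|n IH] p pn; first by rewrite addn0 in pn; rewrite pn drop_size.
  have px : p < size x by lia.
  case xp: (onth x p) => [a|]; last by have := onthTE x p; rewrite xp px.
  apply: (steps_cons _ (IH p.+1 _)); last lia.
  rewrite (drop_nth a px) (onth_nth _ _ _ _ xp) cellsS rev_rcons -/w.
  by rewrite /tm_step /= inordK //= -xp init_cellE.
(* For the empty input the first padding cell is cell 0, hence the flag [size x + k == 0]. *)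
have pad k : k < 4 ->
  step (conf (at_pc 0 (Init (size x + k == 0) k)) (rev (cells w 0 (size x + k))) [::]) =
  conf (at_pc 0 (Init (size x + k.+1 == 0) k.+1)) (rev (cells w 0 (size x + k.+1))) [::].
  move=> k4; have xk : onth x (size x + k) = None by rewrite onth_default // leq_addr.
  rewrite /tm_step /= inordK; last lia.
  by rewrite k4 -xk init_cellE addnS cellsS rev_rcons.
have pads k : k <= 4 ->
  steps (conf (at_pc 0 (Init (size x + 0 == 0) 0)) (rev (cells w 0 (size x + 0))) [::]) k
    (conf (at_pc 0 (Init (size x + k == 0) k)) (rev (cells w 0 (size x + k))) [::]).
  by elim: k => // k IH k4; rewrite /steps iterS IH ?pad //; lia.
have -> : (size x).*2 + 10 = size x + (4 + (1 + (size x + 4).+1)) by rewrite -addnn; lia.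
have := read _ 0 (add0n _); rewrite drop0 ini => r; apply: (steps_trans r).
have := pads 4 isT; rewrite addn0 => {}r; apply: (steps_trans r).
apply: (@steps_trans _ (confL (at_pc 0 Returning) (rev (cells w 0 (size x + 4)) ++ [::]) [:: fence])).
  by rewrite /steps /= /tm_step /= inordK //= cats0.
have -> : (size x + 4).+1 = (size (cells w 0 (size x + 4))).+1 by rewrite size_map size_iota.
by apply: return_left; [exact: all_isSome_map | left].
Qed.
End Machine.

(** * Structured code and its translation into instructions *)

Inductive code :=
  | COp of op | CSeq of code & code | CIf of op & code & code
  | CDo of code & op | CEmit of sym.

(** The last argument counts operations. Tests are operations and may change the store, because an
    increment serves at once as the step and as the exit test of a loop. *)
Inductive exec (S : nat) : code -> store -> store -> nat -> Prop :=
  | EOp o s : exec S (COp o) s (op_sem S o s).1 1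
  | ESeq c1 c2 s1 s2 s3 n1 n2 : exec S c1 s1 s2 n1 -> exec S c2 s2 s3 n2 ->
      exec S (CSeq c1 c2) s1 s3 (n1 + n2)
  | EIf o c1 c2 s s' n :
      exec S (if (op_sem S o s).2 then c1 else c2) (op_sem S o s).1 s' n ->
      exec S (CIf o c1 c2) s s' n.+1
  | EDoStop c o s s' n : exec S c s s' n -> ~~ (op_sem S o s').2 ->
      exec S (CDo c o) s (op_sem S o s').1 n.+1
  | EDoLoop c o s s1 s2 n1 n2 : exec S c s s1 n1 -> (op_sem S o s1).2 ->
      exec S (CDo c o) (op_sem S o s1).1 s2 n2 ->
      exec S (CDo c o) s s2 (n1 + n2).+1
  | EEmit a s : exec S (CEmit a) s (emit s a) 1.

Lemma exec_in_range S c s s' n : exec S c s s' n -> in_range S s -> in_range S s'.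
Proof.
elim=> {c s s' n} [o s|c1 c2 s1 s2 s3 n1 n2 _ IH1 _ IH2|o c1 c2 s s' n _ IH|
  c o s s' n _ IH _|c o s s1 s2 n1 n2 _ IH1 _ _ IH2|a s] sS //.
- exact: op_sem_in_range.
- by apply: IH2; apply: IH1.
- by apply: IH; apply: op_sem_in_range.
- by apply: op_sem_in_range; apply: IH.
- by apply: IH2; apply: op_sem_in_range; apply: IH1.
Qed.

Lemma exec_out S c s s' n : exec S c s s' n ->
  size (out s) <= size (out s') <= size (out s) + n.
Proof.
elim=> {c s s' n} [o s|c1 c2 s1 s2 s3 n1 n2 _ IH1 _ IH2|o c1 c2 s s' n _|
  c o s s' n _|c o s s1 s2 n1 n2 _ IH1 _ _|a s]; rewrite ?op_sem_out //=; try lia.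
by rewrite size_rcons; lia.
Qed.

Fixpoint code_tracks (c : code) : nat :=
  match c with
  | COp o => op_tracks o
  | CSeq c1 c2 => maxn (code_tracks c1) (code_tracks c2)
  | CIf o c1 c2 => maxn (op_tracks o) (maxn (code_tracks c1) (code_tracks c2))
  | CDo c o => maxn (code_tracks c) (op_tracks o)
  | CEmit _ => 0
  end.

Fixpoint len (c : code) : nat :=
  match c with
  | COp _ | CEmit _ => 1
  | CSeq c1 c2 => len c1 + len c2
  | CIf o c1 c2 => (len c1 + len c2).+1
  | CDo c o => len c + 1
  end.

(** [pc] is the address at which the code is placed and [k] the address at which control continues;
    every exit jumps there explicitly. *)
Fixpoint flat (c : code) (pc k : nat) : seq instr :=
  match c with
  | COp o => [:: ISweep o k k]
  | CEmit a => [:: IEmit a k]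
  | CSeq c1 c2 => flat c1 pc (pc + len c1) ++ flat c2 (pc + len c1) k
  | CIf o c1 c2 => ISweep o pc.+1 (pc.+1 + len c1) ::
      flat c1 pc.+1 k ++ flat c2 (pc.+1 + len c1) k
  | CDo c o => flat c pc (pc + len c) ++ [:: ISweep o pc k]
  end.

Lemma size_flat c pc k : size (flat c pc k) = len c.
Proof.
elim: c pc k => [o|c1 IH1 c2 IH2|o c1 IH1 c2 IH2|c IH o|a] pc k //=;
  by rewrite ?size_cat /= ?IH1 ?IH2 ?IH.
Qed.

Definition code_at (P : seq instr) (pc : nat) (l : seq instr) : Prop :=
  forall i a, onth l i = Some a -> onth P (pc + i) = Some a.

Lemma code_at_cat P pc l1 l2 :
  code_at P pc (l1 ++ l2) -> code_at P pc l1 /\ code_at P (pc + size l1) l2.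
Proof.
move=> H; split=> i a li.
  by apply: H; rewrite onth_cat -onthTE li.
by rewrite -addnA; apply: H; rewrite onth_cat ltnNge leq_addr /= addKn.
Qed.

Lemma code_at_head P pc a l : code_at P pc (a :: l) -> onth P pc = Some a.
Proof. by move=> /(_ 0 a erefl); rewrite addn0. Qed.

Lemma code_at_behead P pc a l : code_at P pc (a :: l) -> code_at P pc.+1 l.
Proof. by move=> H i b lb; rewrite addSnnS; apply: H. Qed.

Lemma onth_leq P pc (a : instr) : onth P pc = Some a -> pc <= size P.
Proof. by move=> H; apply: ltnW; rewrite -onthTE H. Qed.

(** Each counted operation is one sweep or one emission, and an emission also walks over the output.
    As the output only grows, its final size bounds the cost of every one of them. *)
Lemma exec_steps T P S c s s' n : exec S c s s' n -> 0 < S -> in_range S s ->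
  code_tracks c <= T -> forall pc k, code_at P pc (flat c pc k) ->
  exists2 t, t <= n * ((S + size (out s')).*2 + 5) &
    steps (T := T) (P := P) (home T P S pc s) t (home T P S k s').
Proof.
move=> + S0; elim=> {c s s' n} [o s|c1 c2 s1 s2 s3 n1 n2 e1 IH1 e2 IH2|o c1 c2 s s' n e IH|
  c o s s' n e IH stop|c o s s1 s2 n1 n2 e1 IH1 loop e2 IH2|a s] sS /= cT pc k.
- move=> /code_at_head Ppc; exists (S.*2 + 3); first by rewrite op_sem_out mul1n doubleD; lia.
  by have := sweep_steps (onth_leq Ppc) Ppc sS S0 cT; case: ifP.
- move=> /code_at_cat[P1]; rewrite size_flat => P2.
  have [|t1 t1B r1] := IH1 sS _ _ _ P1; first lia.
  have [|t2 t2B r2] := IH2 (exec_in_range e1 sS) _ _ _ P2; first lia.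
  exists (t1 + t2); last exact: steps_trans r1 r2.
  have := exec_out e2; rewrite mulnDl; nia.
- move=> Pc; have Ppc := code_at_head Pc.
  have [P1] := code_at_cat (code_at_behead Pc); rewrite size_flat => P2.
  have oT : op_tracks o <= T by lia.
  have r1 := sweep_steps (onth_leq Ppc) Ppc sS S0 oT.
  have oS := op_sem_in_range o sS.
  have ob := op_sem_out S o s.
  have : exists2 t, t <= n * ((S + size (out s')).*2 + 5) &
    steps (T := T) (P := P)
      (home T P S (if (op_sem S o s).2 then pc.+1 else pc.+1 + len c1) (op_sem S o s).1) t
      (home T P S k s').
    by case: ifP IH => _ IH; apply: IH => //; lia.
  move=> [t tB r2]; exists (S.*2 + 3 + t); last exact: steps_trans r1 r2.
  by rewrite mulSn doubleD; lia.
- move=> /code_at_cat[P1]; rewrite size_flat => /code_at_head P2.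
  have [|t1 t1B r1] := IH sS _ _ _ P1; first lia.
  exists (t1 + (S.*2 + 3)); first by rewrite op_sem_out mulSn doubleD; lia.
  apply: steps_trans r1 _.
  have := sweep_steps (T := T) (onth_leq P2) P2 (exec_in_range e sS) S0.
  by rewrite (negbTE stop); apply; lia.
- move=> Pc; have [P1] := code_at_cat Pc; rewrite size_flat => /code_at_head P2.
  have [|t1 t1B r1] := IH1 sS _ _ _ P1; first lia.
  have [|t2 t2B r2] := IH2 (op_sem_in_range o (exec_in_range e1 sS)) _ _ _ Pc; first by [].
  exists (t1 + (S.*2 + 3 + t2)).
    have := exec_out e2; rewrite op_sem_out mulSn mulnDl doubleD; nia.
  apply: (steps_trans r1); apply: steps_trans r2.
  have := sweep_steps (T := T) (onth_leq P2) P2 (exec_in_range e1 sS) S0.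
  by rewrite loop; apply; lia.
- move=> /code_at_head Ppc; exists ((S + size (out s)).*2 + 5).
    by rewrite mul1n /= size_rcons; lia.
  exact: emit_steps (onth_leq Ppc) Ppc.
Qed.

Definition compile (c : code) : TM := machine (code_tracks c) (flat c 0 (len c)).

(** [n] operations emit at most [n] symbols, so the size of the output disappears from the time
    bound. *)
Lemma compile_correct c x s' n : exec (size x + 4) c (store0 x) s' n ->
  exists2 t, t <= n * ((size x + n).*2 + 13) + (size x).*2 + (size x) + 16 &
    tm_result (compile c) x t = Some (out s').
Proof.
move=> e; set S := size x + 4 in e; set P := flat c 0 (len c).
have S0 : 0 < S by rewrite /S; lia.
have [||t tB r] := exec_steps (P := P) e S0 _ (leqnn _) (pc := 0) (k := size P).
- by move=> y; rewrite /S /=; lia.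
- by rewrite size_flat.
have [d [rf [dh dr]]] := final_steps (code_tracks c) P S s'.
have := steps_trans (init_steps (code_tracks c) P x) (steps_trans r rf).
set t' := _ + _ => run; exists t'; last by rewrite /tm_result run dh.
have := exec_out e; rewrite /t' /= -!addnn in tB *; rewrite /S in tB *; nia.
Qed.

(** * A language of polynomial-time programs *)

Inductive expr :=
  | Var of nat | Zero | Succ of expr | Add of expr & expr | Mul of expr & expr
  | Eq of expr & expr | Lt of expr & expr | Mem of nat & expr
  | Ite of expr & expr & expr | Let of nat & expr & expr
  | Fold of nat & nat & expr & expr.

Inductive cmd :=
  | Skip | Wr of nat & expr & expr | Seq of cmd & cmd | If of expr & cmd & cmd
  | For of nat & cmd | Emit of sym.

Definition memory := nat -> nat -> bool.

Section Semantics.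
Variable S : nat.

Fixpoint ev (M : memory) (env : nat -> nat) (e : expr) : nat :=
  match e with
  | Var x => env x
  | Zero => 0
  | Succ e => minn S.-1 (ev M env e).+1
  | Add e1 e2 => minn S.-1 (ev M env e1 + ev M env e2)
  | Mul e1 e2 => minn S.-1 (ev M env e1 * ev M env e2)
  | Eq e1 e2 => ev M env e1 == ev M env e2
  | Lt e1 e2 => ev M env e1 < ev M env e2
  | Mem m e => M m (ev M env e)
  | Ite b e1 e2 => if ev M env b != 0 then ev M env e1 else ev M env e2
  | Let x e1 e2 => ev M (upd env x (ev M env e1)) e2
  | Fold a x e0 e =>
      foldl (fun v p => ev M (upd (upd env a v) x p) e) (ev M env e0) (iota 0 S)
  end.

Fixpoint run (env : nat -> nat) (c : cmd) (st : memory * seq sym) : memory * seq sym :=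
  match c with
  | Skip => st
  | Wr m e b => let p := ev st.1 env e in
      (upd st.1 m (upd (st.1 m) p (ev st.1 env b != 0)), st.2)
  | Seq c1 c2 => run env c2 (run env c1 st)
  | If b c1 c2 => if ev st.1 env b != 0 then run env c1 st else run env c2 st
  | For x c => foldl (fun st p => run (upd env x p) c st) st (iota 0 S)
  | Emit a => (st.1, rcons st.2 a)
  end.
End Semantics.

(** Runs [c] as often as the value of register [y], counting in [k]. The outer test covers the value
    0, since [CDo] tests only after its body. *)
Definition rep (k y : nat) (c : code) : code :=
  CSeq (COp (OZero k))
    (CIf (OLt k y) (CDo (CSeq c (COp (OInc k))) (OLt k y)) (COp (OZero k))).

Definition bool_result (o : op) (r : nat) : code :=
  CIf o (CSeq (COp (OZero r)) (COp (OInc r))) (COp (OZero r)).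

(* [ce rho b e] leaves the value of [e] in register [b], reads the variable [x]
   from register [rho x], and otherwise changes registers above [b] only. *)
Fixpoint ce (rho : nat -> nat) (b : nat) (e : expr) : code :=
  match e with
  | Var x => COp (OCopy b (rho x))
  | Zero => COp (OZero b)
  | Succ e => CSeq (ce rho b e) (COp (OInc b))
  | Add e1 e2 => CSeq (ce rho b e1) (CSeq (ce rho b.+1 e2)
      (rep b.+2 b.+1 (COp (OInc b))))
  | Mul e1 e2 => CSeq (ce rho b.+1 e1) (CSeq (ce rho b.+2 e2) (CSeq (COp (OZero b))
      (rep b.+3 b.+1 (rep b.+4 b.+2 (COp (OInc b))))))
  | Eq e1 e2 => CSeq (ce rho b e1) (CSeq (ce rho b.+1 e2) (bool_result (OEq b b.+1) b))
  | Lt e1 e2 => CSeq (ce rho b e1) (CSeq (ce rho b.+1 e2) (bool_result (OLt b b.+1) b))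
  | Mem m e => CSeq (ce rho b e) (bool_result (OMem m b) b)
  | Ite c e1 e2 => CSeq (ce rho b c) (CSeq (COp (OZero b.+1))
      (CIf (OEq b b.+1) (ce rho b e2) (ce rho b e1)))
  | Let x e1 e2 => CSeq (ce rho b e1) (CSeq (ce (upd rho x b) b.+1 e2) (COp (OCopy b b.+1)))
  | Fold a x e0 e => CSeq (ce rho b e0) (CSeq (COp (OZero b.+1))
      (CDo (CSeq (ce (upd (upd rho a b) x b.+1) b.+2 e) (COp (OCopy b b.+2))) (OInc b.+1)))
  end.

Fixpoint cc (rho : nat -> nat) (b : nat) (c : cmd) : code :=
  match c with
  | Skip => COp (OZero b)
  | Wr m e v => CSeq (ce rho b e) (CSeq (ce rho b.+1 v) (CSeq (COp (OZero b.+2))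
      (CIf (OEq b.+1 b.+2) (COp (OWr m b false)) (COp (OWr m b true)))))
  | Seq c1 c2 => CSeq (cc rho b c1) (cc rho b c2)
  | If e c1 c2 => CSeq (ce rho b e) (CSeq (COp (OZero b.+1))
      (CIf (OEq b b.+1) (cc rho b c2) (cc rho b c1)))
  | For x c => CSeq (COp (OZero b)) (CDo (cc (upd rho x b) b.+1 c) (OInc b))
  | Emit a => CEmit a
  end.

(** To depend on [S] alone, a conditional pays for both branches and every loop for [S] rounds. In
    [Mul], [S * 3 + 5] is one run of the inner [rep] together with the bookkeeping of the outer
    one. *)
Fixpoint ecost (S : nat) (e : expr) : nat :=
  match e with
  | Var _ | Zero => 1
  | Succ e => ecost S e + 1
  | Add e1 e2 => ecost S e1 + ecost S e2 + S * 3 + 3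
  | Mul e1 e2 => ecost S e1 + ecost S e2 + S * (S * 3 + 5) + 4
  | Eq e1 e2 | Lt e1 e2 => ecost S e1 + ecost S e2 + 3
  | Mem _ e => ecost S e + 3
  | Ite b e1 e2 => ecost S b + (ecost S e1 + ecost S e2) + 2
  | Let _ e1 e2 => ecost S e1 + ecost S e2 + 1
  | Fold _ _ e0 e => ecost S e0 + S * (ecost S e + 2) + 1
  end.

Fixpoint ccost (S : nat) (c : cmd) : nat :=
  match c with
  | Skip | Emit _ => 1
  | Wr _ e v => ecost S e + ecost S v + 3
  | Seq c1 c2 => ccost S c1 + ccost S c2
  | If e c1 c2 => ecost S e + (ccost S c1 + ccost S c2) + 2
  | For _ c => S * (ccost S c + 1) + 1
  end.

(** * Correctness and cost of compiled expressions and commands *)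

Section Correct.
Variable S : nat.
Hypothesis S1 : 1 < S.

(** A total-correctness statement for the single initial store [s], with the number of operations
    bounded by [N]. *)
Definition does (c : code) (N : nat) (s : store) (Q : store -> Prop) : Prop :=
  exists s' n, [/\ exec S c s s' n, n <= N & Q s'].

Lemma does_weaken c N N' s (Q Q' : store -> Prop) :
  does c N s Q -> N <= N' -> (forall s', Q s' -> Q' s') -> does c N' s Q'.
Proof.
move=> [s' [n [e nN Qs]]] NN' QQ'; exists s', n; split=> //; [lia | exact: QQ'].
Qed.

Lemma does_op o s (Q : store -> Prop) : Q (op_sem S o s).1 -> does (COp o) 1 s Q.
Proof. by move=> H; exists (op_sem S o s).1, 1; split=> //; constructor. Qed.

Lemma does_seq c1 c2 N1 N2 s (Q1 Q2 : store -> Prop) : does c1 N1 s Q1 ->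
  (forall s', Q1 s' -> does c2 N2 s' Q2) -> does (CSeq c1 c2) (N1 + N2) s Q2.
Proof.
move=> [s1 [n1 [e1 nN1 q1]]] /(_ _ q1) [s2 [n2 [e2 nN2 q2]]].
by exists s2, (n1 + n2); split=> //; [apply: ESeq e1 e2 | lia].
Qed.

Lemma does_if o c1 c2 N s (Q : store -> Prop) :
  does (if (op_sem S o s).2 then c1 else c2) N (op_sem S o s).1 Q ->
  does (CIf o c1 c2) N.+1 s Q.
Proof.
by move=> [s1 [n1 [e1 nN1 q1]]]; exists s1, n1.+1; split=> //; apply: EIf.
Qed.

Lemma does_in_range c N s Q : in_range S s -> does c N s Q ->
  does c N s (fun s' => in_range S s' /\ Q s').
Proof.
by move=> sS [s' [n [e nN q]]]; exists s', n; split=> //; split=> //; apply: exec_in_range e sS.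
Qed.

Lemma does_loop k c N (I : nat -> store -> Prop) s :
  (forall j s v, v < S -> I j s -> I j (setr s k v)) ->
  (forall j s, j < S -> I j s -> reg s k = j ->
     does c N s (fun s' => I j.+1 s' /\ reg s' k = j)) ->
  I 0 s -> reg s k = 0 -> does (CDo c (OInc k)) (S * (N + 1)) s (I S).
Proof.
move=> Iset Ic I0 s0.
suff H d j s' : j + d.+1 = S -> I j s' -> reg s' k = j ->
    does (CDo c (OInc k)) (d.+1 * (N + 1)) s' (I S).
  by have := H S.-1 0 s; rewrite prednK; [apply | lia].
elim: d j s' => [|d IH] j s' jd Ij kj;
  have [|s1 [n1 [e1 nN1 [I1 k1]]]] := Ic j s' _ Ij kj; try lia.
  exists (op_sem S (OInc k) s1).1, n1.+1; split; [|lia|].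
    by apply: EDoStop e1 _ => /=; lia.
  have Sj : j.+1 = S by lia.
  by rewrite Sj in I1; apply: Iset => //; lia.
have [|||s2 [n2 [e2 nN2 I2]]] := IH j.+1 (op_sem S (OInc k) s1).1; first lia.
- by apply: Iset => //; lia.
- by rewrite /= upd_eq k1; lia.
exists s2, (n1 + n2).+1; split=> //; last by rewrite mulSn; lia.
by apply: EDoLoop e1 _ e2 => /=; lia.
Qed.

Lemma does_rep k y c N Y (I : nat -> store -> Prop) s : Y < S -> k != y ->
  (forall j s v, v < S -> I j s -> I j (setr s k v)) ->
  (forall j s, I j s -> reg s y = Y) ->
  (forall j s, j < Y -> I j s -> does c N s (fun s' => I j.+1 s' /\ reg s' k = reg s k)) ->
  I 0 s -> does (rep k y c) (Y * (N + 2) + 3) s (I Y).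
Proof.
move=> YS ky Iset Iy Ic I0.
have loop d j s' : j + d.+1 = Y -> I j s' -> reg s' k = j ->
    does (CDo (CSeq c (COp (OInc k))) (OLt k y)) (d.+1 * (N + 2)) s' (I Y).
  elim: d j s' => [|d IH] j s' jd Ij kj;
    have [|s1 [n1 [e1 nN1 [I1 k1]]]] := Ic j s' _ Ij; try lia.
    exists (op_sem S (OInc k) s1).1, (n1 + 1).+1; split; [|lia|].
      apply: EDoStop; first by apply: ESeq e1 _; constructor.
      by rewrite /= upd_eq upd_neq 1?eq_sym // k1 kj (Iy _ _ I1); lia.
    have Yj : j.+1 = Y by lia.
    by rewrite Yj in I1; apply: Iset => //; lia.
  have I1' : I j.+1 (op_sem S (OInc k) s1).1 by apply: Iset => //; lia.
  have k1' : reg (op_sem S (OInc k) s1).1 k = j.+1 by rewrite /= upd_eq k1; lia.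
  have [|s2 [n2 [e2 nN2 I2]]] := IH j.+1 _ _ I1' k1'; first lia.
  exists s2, (n1 + 1 + n2).+1; split=> //; last by rewrite mulSn; lia.
  apply: (EDoLoop (s1 := (op_sem S (OInc k) s1).1)) e2; first by apply: ESeq e1 _; constructor.
  suff : reg (op_sem S (OInc k) s1).1 k < reg (op_sem S (OInc k) s1).1 y by [].
  by rewrite k1' (Iy _ _ I1'); lia.
apply: (@does_weaken _ (1 + (Y * (N + 2) + 1).+1) _ _ (I Y)) => //; last lia.
have I0' : I 0 (setr s k 0) by apply: Iset => //; lia.
apply: (does_seq (Q1 := fun s' => s' = setr s k 0)); first exact: does_op.
move=> _ ->; apply: does_if; rewrite /= upd_eq upd_neq 1?eq_sym // (Iy _ _ I0).
case: ltnP => Y0.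
  have Yp : Y = Y.-1.+1 by lia.
  apply: (does_weaken (loop Y.-1 0 _ _ I0' _)) => //; try lia.
  by rewrite /= upd_eq.
have Y00 : Y = 0 by lia.
apply: (@does_weaken _ 1 _ _ (I Y)) => //; last lia.
by apply: does_op; rewrite Y00; apply: Iset => //; lia.
Qed.

(** Registers are used as a stack: those below [b] hold variables and pending values, and the
    evaluation of an expression may touch only the others. *)
Definition framed (b : nat) (s0 s : store) : Prop :=
  [/\ in_range S s, forall r, r < b -> reg s r = reg s0 r, ram s = ram s0 & out s = out s0].

Lemma framed_setr b s0 s x v : framed b s0 s -> b <= x -> v < S -> framed b s0 (setr s x v).
Proof.
move=> [sS fr me ou] bx vS; split=> //= r; rewrite ?/(reg _ _) /= /upd; case: eqP => //.
  by move=> -> xb; lia.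
by move=> _; apply: fr.
Qed.

Lemma framed_trans b b' s0 s1 s2 : framed b s0 s1 -> framed b' s1 s2 -> b <= b' -> framed b s0 s2.
Proof.
move=> [_ f1 m1 o1] [sS f2 m2 o2] bb; split=> //; rewrite ?m2 ?o2 // => r rb.
by rewrite f2 ?f1 //; lia.
Qed.

Lemma framed_refl b s : in_range S s -> framed b s s.
Proof. by []. Qed.

Definition linked (rho env : nat -> nat) (b : nat) (s : store) : Prop :=
  forall x, rho x < b /\ reg s (rho x) = env x.

Lemma linked_eq rho env b b' s0 s : linked rho env b s0 ->
  (forall r, r < b -> reg s r = reg s0 r) -> b <= b' -> linked rho env b' s.
Proof. by move=> l f bb x; have [lx e] := l x; rewrite f //; split=> //; lia. Qed.

Lemma linked_framed rho env b b' s0 s :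
  linked rho env b s0 -> framed b s0 s -> b <= b' -> linked rho env b' s.
Proof. by move=> l [_ f _ _]; apply: linked_eq l f. Qed.

Lemma linked_upd rho env b s x r : linked rho env b s -> r < b ->
  linked (upd rho x r) (upd env x (reg s r)) b s.
Proof. by move=> l rb y; rewrite /upd; case: eqP. Qed.

Lemma does_bool o r s0 s : framed r s0 s ->
  (forall s, (op_sem S o s).1 = s) ->
  does (bool_result o r) 3 s (fun s' => framed r s0 s' /\ reg s' r = (op_sem S o s).2).
Proof.
move=> fr os; apply: does_if; rewrite os; case: (op_sem S o s).2.
  apply: (does_seq (N1 := 1) (N2 := 1) (Q1 := fun s' => s' = setr s r 0)); first exact: does_op.
  move=> _ ->; apply: does_op => /=; rewrite !upd_eq; split; last lia.
  have f0 : framed r s0 (setr s r 0) by apply: framed_setr => //; lia.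
  by apply: framed_setr => //; lia.
suff H : does (COp (OZero r)) 1 s (fun s' => framed r s0 s' /\ reg s' r = false).
  exact: does_weaken H _ _.
by apply: does_op; rewrite /= upd_eq; split=> //; apply: framed_setr => //; lia.
Qed.

Lemma ce_correct e rho env b s : linked rho env b s -> in_range S s ->
  does (ce rho b e) (ecost S e) s
    (fun s' => framed b s s' /\ reg s' b = ev S (ram s) env e).
Proof.
elim: e rho env b s => [x| |e IH|e1 IH1 e2 IH2|e1 IH1 e2 IH2|e1 IH1 e2 IH2|e1 IH1 e2 IH2|
  m e IH|e0 IH0 e1 IH1 e2 IH2|x e1 IH1 e2 IH2|a x e1 IH1 e2 IH2] rho env b s l sS /=.
- apply: does_op => /=; rewrite upd_eq; case: (l x) => _ <-; split=> //.
  exact: framed_setr.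
- by apply: does_op => /=; rewrite upd_eq; split=> //; apply: framed_setr => //; lia.
- apply: does_seq (IH _ _ _ _ l sS) _ => s1 [f1 r1]; apply: does_op => /=.
  by rewrite upd_eq r1; split=> //; apply: framed_setr => //; lia.
- apply: (@does_weaken _ (ecost S e1 + (ecost S e2 + (S.-1 * (1 + 2) + 3)))); last by move=> s'; exact.
    apply: does_seq (IH1 _ _ _ _ l sS) _ => s1 [f1 r1].
    have [sS1 _ m1 _] := f1.
    apply: does_seq (IH2 _ _ b.+1 _ (linked_framed l f1 _) sS1) _ => // s2 [f2 r2].
    have [sS2 f2' _ _] := f2; have f12 := framed_trans f1 f2 (leqnSn _).
    set v := ev S (ram s) env e1 in r1 *; set w := ev S (ram s) env e2.
    have r2' : reg s2 b.+1 = w by rewrite r2 m1.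
    have r1' : reg s2 b = v by rewrite f2' ?r1.
    have wS : w < S by rewrite -r2'.
    pose I j s' := [/\ framed b s s', reg s' b.+1 = w & reg s' b = minn S.-1 (v + j)].
    have vS : v < S by rewrite -r1'.
    apply: (@does_weaken _ _ _ _ _ _ (@does_rep b.+2 b.+1 _ 1 w I s2 wS _ _ _ _ _)).
    + by rewrite eqn_leq ltnn.
    + move=> j s' u uS [f y z]; split; first by apply: framed_setr => //; lia.
        by rewrite /= upd_neq ?y //; lia.
      by rewrite /= upd_neq ?z //; lia.
    + by move=> j s' [].
    + move=> j s' jw [f y z]; apply: does_op => /=; split; last by rewrite upd_neq //; lia.
      split; first by apply: framed_setr => //; lia.
        by rewrite /= upd_neq ?y //; lia.
      by rewrite /= upd_eq z; lia.
    + by split=> //; rewrite r1'; lia.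
    + by rewrite leq_add2r leq_mul2r; apply/orP; right; lia.
    + by move=> s' [f _ ->].
  lia.
- apply: (@does_weaken _ (ecost S e1 + (ecost S e2 + (1 + (S * (S * 3 + 5) + 3)))));
    [|lia|by move=> s'; exact].
  apply: does_seq (IH1 _ _ b.+1 _ (linked_framed l (framed_refl b sS) (leqnSn b)) sS) _.
  move=> s1 [f1 r1]; have [sS1 _ m1 _] := f1.
  have l1 := linked_framed (linked_framed l (framed_refl b sS) (leqnSn b)) f1 (leqnSn _).
  apply: does_seq (IH2 _ _ b.+2 _ l1 sS1) _ => // s2 [f2 r2].
  have [sS2 f2' _ _] := f2; have f12 := framed_trans f1 f2 (leqnSn _).
  set v := ev S (ram s) env e1 in r1 *; set w := ev S (ram s) env e2.
  have r2' : reg s2 b.+2 = w by rewrite r2 m1.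
  have r1' : reg s2 b.+1 = v by rewrite f2' ?r1.
  have wS : w < S by rewrite -r2'.
  have vS : v < S by rewrite -r1'.
  apply: (does_seq (Q1 := fun s' => s' = setr s2 b 0)); first exact: does_op.
  move=> _ ->.
  pose I j s' := [/\ framed b s s', reg s' b.+1 = v, reg s' b.+2 = w
    & reg s' b = minn S.-1 (j * w)].
  have I0 : I 0 (setr s2 b 0).
    split; rewrite /= ?upd_eq ?upd_neq //; try lia.
    apply: framed_setr => //; last lia.
    exact: framed_trans (framed_refl b sS) f12 (leqnSn b).
  have vw : v * (w * 3 + 5) <= S * (S * 3 + 5) by apply: leq_mul; lia.
  apply: (@does_weaken _ _ _ _ _ _ (@does_rep b.+3 b.+1 _ (w * (1 + 2) + 3) v I _ vS _ _ _ _ I0)).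
  + by lia.
  + move=> j s' u uS [f y z t]; split; rewrite /= ?upd_neq //; try lia.
    by apply: framed_setr => //; lia.
  + by move=> j s' [].
  + move=> j s' jv [f y z t].
    pose J i s'' := [/\ framed b s s'', reg s'' b.+1 = v, reg s'' b.+2 = w,
      reg s'' b = minn S.-1 (j * w + i) & reg s'' b.+3 = reg s' b.+3].
    apply: (@does_weaken _ _ _ _ _ _ (@does_rep b.+4 b.+2 _ 1 w J _ wS _ _ _ _ _)) => //.
    * by lia.
    * move=> i s'' u uS [f' y' z' t' h']; split; rewrite /= ?upd_neq //; try lia.
      by apply: framed_setr => //; lia.
    * by move=> i s'' [].
    * move=> i s'' iw [f' y' z' t' h']; apply: does_op => /=.
      split; last by rewrite upd_neq //; lia.
      split; rewrite /= ?upd_eq ?upd_neq //; try lia.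
      by apply: framed_setr => //; lia.
    * by split=> //; rewrite addn0.
    * by move=> s'' [f' y' z' t' h']; split=> //; split=> //; rewrite t' mulSn addnC.
  + by rewrite -addnA; lia.
  + by move=> s' [].
- apply: (@does_weaken _ (ecost S e1 + (ecost S e2 + 3))); [|lia|by move=> s'; exact].
  apply: does_seq (IH1 _ _ _ _ l sS) _ => s1 [f1 r1].
  have [sS1 _ m1 _] := f1.
  apply: does_seq (IH2 _ _ b.+1 _ (linked_framed l f1 _) sS1) _ => // s2 [f2 r2].
  have [_ f2' _ _] := f2; have f12 := framed_trans f1 f2 (leqnSn _).
  apply: (does_weaken (does_bool f12 _)) => // s' [f' ->]; split=> //=.
  by rewrite r2 m1 f2' ?r1.
- apply: (@does_weaken _ (ecost S e1 + (ecost S e2 + 3))); [|lia|by move=> s'; exact].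
  apply: does_seq (IH1 _ _ _ _ l sS) _ => s1 [f1 r1].
  have [sS1 _ m1 _] := f1.
  apply: does_seq (IH2 _ _ b.+1 _ (linked_framed l f1 _) sS1) _ => // s2 [f2 r2].
  have [_ f2' _ _] := f2; have f12 := framed_trans f1 f2 (leqnSn _).
  apply: (does_weaken (does_bool f12 _)) => // s' [f' ->]; split=> //=.
  by rewrite r2 m1 f2' ?r1.
- apply: does_seq (IH _ _ _ _ l sS) _ => s1 [f1 r1].
  have [_ _ m1 _] := f1.
  by apply: (does_weaken (does_bool f1 _)) => // s' [f' ->]; split=> //=; rewrite r1 m1.
- apply: (@does_weaken _ (ecost S e0 + (1 + (ecost S e1 + ecost S e2).+1))); [|lia|by move=> s'; exact].
  apply: does_seq (IH0 _ _ _ _ l sS) _ => s1 [f1 r1].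
  apply: (does_seq (Q1 := fun s' => s' = setr s1 b.+1 0)); first exact: does_op.
  have f2 : framed b s (setr s1 b.+1 0) by apply: framed_setr => //; lia.
  have [sS2 _ m2 _] := f2.
  move=> _ ->; apply: does_if; rewrite /= upd_eq upd_neq; last by lia.
  rewrite r1; case: eqP => _ /=.
    have := IH2 _ _ b _ (linked_framed l f2 (leqnn _)) sS2; rewrite m2 => H.
    by apply: (does_weaken H); [lia | move=> s' [f' ->]; split=> //; apply: framed_trans f2 f' _].
  have := IH1 _ _ b _ (linked_framed l f2 (leqnn _)) sS2; rewrite m2 => H.
  by apply: (does_weaken H); [lia | move=> s' [f' ->]; split=> //; apply: framed_trans f2 f' _].
- apply: (@does_weaken _ (ecost S e1 + (ecost S e2 + 1))); [|lia|by move=> s'; exact].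
  apply: does_seq (IH1 _ _ _ _ l sS) _ => s1 [f1 r1].
  have [sS1 _ m1 _] := f1.
  have l1 := linked_upd x (linked_framed l f1 (leqnSn _)) (ltnSn b).
  apply: does_seq (IH2 _ _ _ _ l1 sS1) _ => s2 [f2 r2].
  have [sS2 _ _ _] := f2.
  apply: does_op => /=; rewrite upd_eq r2 m1 r1; split=> //.
  by apply: framed_setr => //; [apply: framed_trans f1 f2 _ | rewrite -r1 -m1 -r2].
- apply: (@does_weaken _ (ecost S e1 + (1 + S * (ecost S e2 + 1 + 1))));
    [|lia|by move=> s'; exact].
  apply: does_seq (IH1 _ _ _ _ l sS) _ => s1 [f1 r1].
  apply: (does_seq (Q1 := fun s' => s' = setr s1 b.+1 0)); first exact: does_op.
  move=> _ ->; set v := ev S (ram s) env e1 in r1 *.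
  pose I j s' := framed b s s' /\
    reg s' b = foldl (fun v p => ev S (ram s) (upd (upd env a v) x p) e2) v (iota 0 j).
  apply: (@does_weaken _ _ _ _ _ _ (@does_loop b.+1 _ (ecost S e2 + 1) I _ _ _ _ _)) => //.
  + move=> j s' u uS [f y]; split; last by rewrite /= upd_neq //; lia.
    by apply: framed_setr => //; lia.
  + move=> j s' jS [f y] kj; have [sS' _ m' _] := f.
    have l' : linked (upd (upd rho a b) x b.+1) (upd (upd env a (reg s' b)) x (reg s' b.+1)) b.+2 s'.
      by do 2?apply: linked_upd => //; apply: linked_framed l f _; lia.
    apply: does_seq (IH2 _ _ _ _ l' sS') _ => s2 [f2 r2]; have [sS2 f2' _ _] := f2.
    apply: does_op; split; last by rewrite /= upd_neq ?f2' //; lia.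
    split.
      by apply: framed_setr => //; apply: framed_trans f f2 _; lia.
    by rewrite -[j.+1]addn1 iotaD foldl_cat /= upd_eq r2 m' -y kj.
  + split; first by apply: framed_setr => //; lia.
    by rewrite /= upd_neq ?r1 //; lia.
  + by rewrite /= upd_eq.
Qed.

Lemma cc_correct c rho env b s : linked rho env b s -> in_range S s ->
  does (cc rho b c) (ccost S c) s
    (fun s' => (forall r, r < b -> reg s' r = reg s r) /\
               (ram s', out s') = run S env c (ram s, out s)).
Proof.
elim: c rho env b s => [|m e v|c1 IH1 c2 IH2|e c1 IH1 c2 IH2|x c IH|a] rho env b s l sS /=.
- apply: does_op => /=; split=> // r rb; rewrite upd_neq //; lia.
- apply: (@does_weaken _ (ecost S e + (ecost S v + (1 + 1.+1)))); [|lia|by move=> s'; exact].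
  apply: does_seq (ce_correct e l sS) _ => s1 [f1 r1]; have [sS1 f1' m1 o1] := f1.
  apply: does_seq (ce_correct v (linked_framed l f1 (leqnSn b)) sS1) _ => s2 [f2 r2].
  have [sS2 f2' m2 o2] := f2.
  apply: (does_seq (Q1 := fun s' => s' = setr s2 b.+2 0)); first exact: does_op.
  move=> _ ->; apply: does_if; rewrite /= upd_eq upd_neq; last by lia.
  have H B : does (COp (OWr m b B)) 1 (setr s2 b.+2 0) (fun s' =>
      (forall r, r < b -> reg s' r = reg s r) /\
      (ram s', out s') = (upd (ram s) m (upd (ram s m) (ev S (ram s) env e) B), out s)).
    apply: does_op; split=> [r rb|] /=.
      by rewrite upd_neq ?f2' ?f1' //; lia.
    by rewrite upd_neq ?f2' ?r1 ?m2 ?m1 ?o2 ?o1 //; lia.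
  by rewrite r2 m1; case: eqP => _ /=; apply: H.
- apply: does_seq (does_in_range sS (IH1 _ _ _ _ l sS)) _ => s1 [sS1 [f1 E]].
  apply: (does_weaken (IH2 _ _ _ _ (linked_eq l f1 (leqnn _)) sS1)) => // s' [f2 ->].
  by rewrite E; split=> // r rb; rewrite f2 ?f1.
- apply: (@does_weaken _ (ecost S e + (1 + (ccost S c1 + ccost S c2).+1))); [|lia|by move=> s'; exact].
  apply: does_seq (ce_correct e l sS) _ => s1 [f1 r1].
  apply: (does_seq (Q1 := fun s' => s' = setr s1 b.+1 0)); first exact: does_op.
  have f2 : framed b s (setr s1 b.+1 0) by apply: framed_setr => //; lia.
  have [sS2 f2' m2 o2] := f2.
  move=> _ ->; apply: does_if; rewrite /= upd_eq upd_neq; last by lia.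
  rewrite r1; case: eqP => _ /=.
    have := IH2 _ _ b _ (linked_framed l f2 (leqnn _)) sS2; rewrite m2 o2 => H.
    by apply: (does_weaken H); [lia | move=> s' [f' ->]; split=> // r rb; rewrite f' // f2'].
  have := IH1 _ _ b _ (linked_framed l f2 (leqnn _)) sS2; rewrite m2 o2 => H.
  by apply: (does_weaken H); [lia | move=> s' [f' ->]; split=> // r rb; rewrite f' // f2'].
- rewrite addnC; apply: (does_seq (Q1 := fun s' => s' = setr s b 0)); first exact: does_op.
  move=> _ ->.
  pose I j s' := [/\ in_range S s', forall r, r < b -> reg s' r = reg s r &
    (ram s', out s') =
      foldl (fun st p => run S (upd env x p) c st) (ram s, out s) (iota 0 j)].
  apply: (@does_weaken _ _ _ _ _ _ (@does_loop b _ (ccost S c) I _ _ _ _ _)) => //.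
  + move=> j s' u uS [sS' f' E]; split=> // r; rewrite /= /upd; case: eqP => //; [lia|].
    by move=> _; apply: f'.
  + move=> j s' jS [sS' f' E] kj.
    have l' : linked (upd rho x b) (upd env x (reg s' b)) b.+1 s'.
      by apply: linked_upd => //; apply: linked_eq l f' _.
    apply: (does_weaken (does_in_range sS' (IH _ _ _ _ l' sS'))) => // s2 [sS2 [f2 E2]].
    split; last by rewrite f2.
    split=> // [r rb|]; first by rewrite f2 ?f' //; lia.
    by rewrite -[j.+1]addn1 iotaD foldl_cat /= -E E2 kj.
  + by split=> // [r|r rb]; rewrite /= /upd; case: eqP => //; lia.
  + by rewrite /= upd_eq.
  + by move=> s' [].
- exists (emit s a), 1; split=> //; exact: EEmit.
Qed.
End Correct.

(** * Polynomial bounds *)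

Definition poly_bounded (f : nat -> nat) : Prop :=
  exists k, forall S, 4 <= S -> f S <= S ^ k.

Lemma expn_monol m n k : m <= n -> m ^ k <= n ^ k.
Proof. by case: k => // k mn; rewrite leq_exp2r. Qed.

Lemma poly_const c : poly_bounded (fun=> c).
Proof.
by exists c => S S4; apply: leq_trans (ltnW (ltn_expl c (isT : 1 < 2))) _; apply: expn_monol; lia.
Qed.

Lemma poly_id : poly_bounded id.
Proof. by exists 1. Qed.

(** For positive [A] and [B] the sum is at most [2 * (A * B)], and raising the exponent by one
    absorbs the factor 2. *)
Lemma poly_add f g : poly_bounded f -> poly_bounded g -> poly_bounded (fun S => f S + g S).
Proof.
move=> [a fa] [b gb]; exists (a + b).+1 => S S4; rewrite expnS expnD.
have := fa S S4; have := gb S S4.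
have : 0 < S ^ a by rewrite expn_gt0; lia.
have : 0 < S ^ b by rewrite expn_gt0; lia.
move: (S ^ a) (S ^ b) => A B B0 A0 gB fA.
apply: (@leq_trans (2 * (A * B))); last by rewrite leq_mul2r; lia.
have := leq_pmulr A B0; have := leq_pmull B A0; lia.
Qed.

Lemma poly_mul f g : poly_bounded f -> poly_bounded g -> poly_bounded (fun S => f S * g S).
Proof. by move=> [a fa] [b gb]; exists (a + b) => S S4; rewrite expnD leq_mul ?fa ?gb. Qed.

Lemma ecost_poly e : poly_bounded (ecost^~ e).
Proof.
elim: e => *; repeat (assumption || exact: poly_const || exact: poly_id ||
  apply: poly_add || apply: poly_mul).
Qed.

Lemma ccost_poly c : poly_bounded (ccost^~ c).
Proof.
elim: c => *; repeat (assumption || exact: ecost_poly || exact: poly_const || exact: poly_id ||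
  apply: poly_add || apply: poly_mul).
Qed.

Theorem cmd_poly_time (c : cmd) : exists (M : TM) (K : nat), forall x : seq sym,
  exists t, t <= K * size x ^ K + K /\
    tm_result M x t =
      Some (run (size x + 4) (fun=> 0) c (fun m p => sym_bit m (onth x p), [::])).2.
Proof.
pose f S := ccost S c.
have [k fk] : poly_bounded (fun S => f S * ((S + f S) * 2 + 13) + S * 3 + 16).
  have pf : poly_bounded f by exact: ccost_poly.
  by repeat (assumption || exact: poly_const || exact: poly_id ||
    apply: poly_add || apply: poly_mul).
(* For a non-empty input [size x + 4 <= 5 * size x], whence the factor [5 ^ k]. It also exceeds
   [4 ^ k], the bound for the empty input, and [k], so that it can serve as the exponent. *)
exists (compile (cc (fun=> 0) 1 c)), (5 ^ k) => x; set S := size x + 4.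
have S1 : 1 < S by rewrite /S; lia.
have S4 : 4 <= S by rewrite /S; lia.
have [||s' [n [e nN [_ E]]]] := @cc_correct S S1 c (fun=> 0) (fun=> 0) 1 (store0 x).
- by [].
- by move=> y; rewrite /S /=; lia.
have [t tB r] := compile_correct e.
exists t; split; last by rewrite r -[out s']/(ram s', out s').2 E.
have {}fk := fk S S4.
have tS : t <= S ^ k.
  apply: leq_trans tB (leq_trans _ fk).
  have nf0 : n <= f S by [].
  have xS : size x <= S by apply: leq_addr.
  have nf : n * (2 * (size x + n) + 13) <= f S * ((S + f S) * 2 + 13).
    apply: leq_mul => //; clearbody S; lia.
  rewrite -!mul2n; clearbody S; lia.
apply: leq_trans tS _; rewrite /S; case: (size x) => [|m].
  by rewrite addnC; apply: leq_trans (leq_addl _ _); apply: expn_monol.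
have k5 : k <= 5 ^ k by apply: ltnW; apply: ltn_expl.
apply: leq_trans (leq_addr _ _).
apply: (@leq_trans ((5 * m.+1) ^ k)); first by apply: expn_monol; lia.
by rewrite expnMn leq_mul2l leq_pexp2l // orbT.
Qed.

(** * Realisations with two extra vertices *)

Section Characterisation.
Variables (n : nat) (D : 'I_n -> 'I_n -> nat).

Definition between (i j : 'I_n) : bool :=
  [exists k, [&& k != i, k != j & D i k + D k j == D i j]].

Definition critical (d : nat) (i j : 'I_n) : bool := (D i j == d) && ~~ between i j.

Definition hub_edge : bool := [exists i, exists j, critical 3 i j].

Definition admissible : Prop :=
  [/\ forall i j, D i j = D j i, forall i j, (D i j == 0) = (i == j),
      forall i j k, D i j <= D i k + D k j & forall i j, 3 < D i j -> between i j].

(* [A g] is the set of terminals adjacent to the extra vertex [g]. *)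
Definition grouping (A : bool -> 'I_n -> bool) : Prop :=
  [/\ forall g i j, A g i -> A g j -> D i j <= 2,
      hub_edge -> forall g i j, A g i -> A (~~ g) j -> D i j <= 3,
      forall i j, critical 2 i j -> exists g, A g i && A g j
    & forall i j, critical 3 i j -> exists g, A g i && A (~~ g) j].

Definition hub_adj (A : bool -> 'I_n -> bool) : rel 'I_(n + 2) :=
  fun u v => match split u, split v with
  | inl i, inl j => D i j == 1
  | inl i, inr g | inr g, inl i => A (g == 1 :> nat) i
  | inr g, inr h => hub_edge && (g != h)
  end.

Definition hub (g : bool) : 'I_(n + 2) := rshift n (inord g).

(** * From a grouping to a realisation *)

Section Realise.
Variable A : bool -> 'I_n -> bool.
Hypothesis Dok : admissible.
Hypothesis Aok : grouping A.

Local Notation e := (hub_adj A).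
Local Notation term := (@lshift n 2).

Lemma split_lshift m k (i : 'I_m) : split (lshift k i) = inl i.
Proof. exact: (unsplitK (inl i)). Qed.

Lemma split_rshift m k (i : 'I_k) : split (rshift m i) = inr i.
Proof. exact: (unsplitK (inr i)). Qed.

Lemma adj_term i j : e (term i) (term j) = (D i j == 1).
Proof. by rewrite /hub_adj !split_lshift. Qed.

Lemma adj_hub i g : e (term i) (hub g) = A g i.
Proof. by rewrite /hub_adj split_lshift split_rshift inordK; case: g. Qed.

Lemma hub_adj_term i g : e (hub g) (term i) = A g i.
Proof. by rewrite /hub_adj split_lshift split_rshift inordK; case: g. Qed.

Lemma adj_hubs g h : e (hub g) (hub h) = hub_edge && (g != h).
Proof.
rewrite /hub_adj !split_rshift; congr (_ && _).
by rewrite -val_eqE /= !inordK; case: g; case: h.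
Qed.

Variant vertex_spec (u : 'I_(n + 2)) : Type :=
  | VTerm i of u = term i | VHub g of u = hub g.

Lemma vertexP u : vertex_spec u.
Proof.
case: (split_ordP u) => [i ->|k ->]; first exact: VTerm.
apply: (VHub (g := k == 1 :> nat)); congr rshift; apply/val_inj.
by rewrite /= inordK; case: k => [[|[|k]]].
Qed.

Lemma hub_adj_simple : simple_graph e.
Proof.
have [Dsym D0 _ _] := Dok; split.
  move=> u v; case: (vertexP u) => [i ->|g ->]; case: (vertexP v) => [j ->|h ->];
  by rewrite ?adj_term ?adj_hub ?hub_adj_term ?adj_hubs 1?Dsym 1?eq_sym.
move=> u; case: (vertexP u) => [i ->|g ->]; rewrite ?adj_term ?adj_hubs ?eqxx ?andbF //.
by have := D0 i i; rewrite eqxx => /eqP ->.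
Qed.

(* Sharp enough to be preserved by every edge, including the one between the
   two hubs. *)
Definition lower_bound (j : 'I_n) (m : nat) (u : 'I_(n + 2)) : Prop :=
  (forall i, u = term i -> D i j <= m) /\
  (forall g, u = hub g -> (forall i, A g i -> D i j <= m.+1) /\
     (hub_edge -> forall i, A (~~ g) i -> D i j <= m.+2)).

Lemma term_hub i g : term i <> hub g.
Proof. by move/(congr1 val) => /=; have := ltn_ord i; lia. Qed.

(** Each kind of edge has its own reason: the triangle inequality between terminals, the bound at
    the hub itself from a terminal to a hub, the two distance conditions of [grouping] from a hub to
    a terminal. The edge between the hubs exchanges the two halves of the bound. *)
Lemma lower_bound_step j m u v : e u v -> lower_bound j m v -> lower_bound j m.+1 u.
Proof.
have [Dsym D0 Dtri _] := Dok; have [A2 A3 _ _] := Aok.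
move=> uv [vT vH]; split=> [i uE|g uE]; move: uv; rewrite uE;
    case: (vertexP v) => [k vE|h vE]; rewrite vE ?adj_term ?adj_hub ?hub_adj_term ?adj_hubs.
- by move=> /eqP Dik; have := vT k vE; have := Dtri i j k; lia.
- by move=> Ahi; have [H _] := vH h vE; apply: H.
- move=> Agk; have Dkj := vT k vE; split=> [i Agi|ab i Agi].
    by have := A2 _ _ _ Agi Agk; have := Dtri i j k; lia.
  by have := A3 ab g k i Agk Agi; rewrite Dsym; have := Dtri i j k; lia.
- move=> /andP[ab gh]; have [H1 H2] := vH h vE.
  have hE : h = ~~ g by case: (g) gh; case: (h).
  split=> [i Agi|_ i Agi]; first by apply: H2 => //; rewrite hE negbK.
  by apply: leqW; apply: leqW; apply: H1; rewrite hE.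
Qed.

Lemma walk_lower_bound j u p : path e u p -> last u p = term j ->
  lower_bound j (size p) u.
Proof.
have [_ D0 _ _] := Dok.
elim: p u => [|v p IH] u /=; last first.
  by move=> /andP[uv pv] lv; apply: lower_bound_step uv (IH _ pv lv).
move=> _ ->; split=> [i /lshift_inj<-|g /term_hub//].
by have := D0 j j; rewrite eqxx => /eqP->.
Qed.

Lemma walk_cat (u v w : 'I_(n + 2)) a b : walk e u v a -> walk e v w b -> walk e u w (a + b).
Proof.
move=> [p [<- [pp pl]]] [q [<- [qp ql]]]; exists (p ++ q).
by rewrite size_cat cat_path last_cat pl pp qp.
Qed.

Lemma walk_edge (u v : 'I_(n + 2)) : e u v -> walk e u v 1.
Proof. by move=> uv; exists [:: v]; rewrite /= uv. Qed.

(** Induction on the distance: a terminal between [i] and [j] splits the pair into two strictly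
    closer ones, and a critical pair is at distance at most 3 and is served by an edge or through
    the hubs. *)
Lemma walk_term i j : walk e (term i) (term j) (D i j).
Proof.
have [Dsym D0 Dtri D3] := Dok; have [_ _ A2 A3] := Aok.
have [m] := ubnP (D i j); elim: m i j => // m IH i j Dm.
have [btw|nbtw] := boolP (between i j).
  have /existsP[k /and3P[ki kj /eqP E]] := btw.
  have : D i k != 0 by rewrite D0 eq_sym.
  have : D k j != 0 by rewrite D0.
  by rewrite -E => kj0 ik0; apply: walk_cat; apply: IH; lia.
have crit d : D i j = d -> critical d i j by rewrite /critical nbtw andbT => ->.
have D4 : D i j <= 3 by rewrite leqNgt; apply/negP => /D3; exact/negP.
case E: (D i j) D4 => [|[|[|[|//]]]] _.
- by exists [::]; move/eqP: E; rewrite D0 => /eqP ->.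
- by apply: walk_edge; rewrite adj_term E.
- have [g /andP[gi gj]] := A2 _ _ (crit _ E).
  apply: (@walk_cat _ (hub g) _ 1 1); apply: walk_edge; by rewrite ?adj_hub ?hub_adj_term.
- have [g /andP[gi gj]] := A3 _ _ (crit _ E).
  have ab : hub_edge by apply/existsP; exists i; apply/existsP; exists j; apply: crit.
  apply: (@walk_cat _ (hub g) _ 1 2); first by apply: walk_edge; rewrite adj_hub.
  apply: (@walk_cat _ (hub (~~ g)) _ 1 1); apply: walk_edge; rewrite ?hub_adj_term //.
  by rewrite adj_hubs ab; case: (g).
Qed.

Theorem hub_realisation : realisation D e term.
Proof.
split; first exact: hub_adj_simple.
split; first exact: lshift_inj.
move=> i j; split; first exact: walk_term.
move=> k kD [p [pk [pp pl]]].
by have [/(_ i erefl)] := walk_lower_bound pp pl; lia.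
Qed.
End Realise.

(** * From a realisation to a grouping *)

Section Necessary.
Variables (N : nat) (e : rel 'I_N) (Phi : 'I_n -> 'I_N).
Hypothesis real : realisation D e Phi.
Hypothesis Nn : N <= n + 2.

Lemma walk_ge i j p : path e (Phi i) p -> last (Phi i) p = Phi j -> D i j <= size p.
Proof.
have [_ [_ dist]] := real; move=> pp pl; rewrite leqNgt; apply/negP => lt.
by have [_ /(_ _ lt)] := dist i j; apply; exists p.
Qed.

Lemma walk_shortest i j :
  exists p, [/\ size p = D i j, path e (Phi i) p & last (Phi i) p = Phi j].
Proof. by have [_ [_ /(_ i j) [[p [? []]]]]] := real; exists p. Qed.

Lemma dist_symm i j : D i j = D j i.
Proof.
have [[es _] _] := real.
suff H i' j' : D i' j' <= D j' i' by apply/eqP; rewrite eqn_leq !H.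
have [p [<- pp pl]] := walk_shortest j' i'.
have := walk_ge (p := rev (belast (Phi j') p)); rewrite size_rev size_belast; apply.
  have := rev_path e (Phi j') p; rewrite pl => ->.
  by rewrite (eq_path (e' := e)) // => u v /=; rewrite es.
by case: p pl {pp} => [|u p] /= pl; rewrite ?pl // rev_cons last_rcons.
Qed.

Lemma dist_zero i j : (D i j == 0) = (i == j).
Proof.
have [_ [Pinj _]] := real.
apply/eqP/eqP => [ij|->]; last by apply/eqP; rewrite -leqn0; apply: (@walk_ge j j [::]).
have [p [/eqP + _ pl]] := walk_shortest i j; rewrite ij size_eq0 => /eqP pE.
by apply: Pinj; rewrite -pl pE.
Qed.

Lemma dist_triangle i j k : D i j <= D i k + D k j.
Proof.
have [p [<- pp pl]] := walk_shortest i k; have [q [<- qp ql]] := walk_shortest k j.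
by rewrite -size_cat; apply: walk_ge; rewrite ?cat_path ?last_cat ?pl ?pp.
Qed.

(** Neither piece of the walk is shorter than the distance it spans, and together they are as long
    as [D i j]; the triangle inequality then makes both pieces exact. *)
Lemma between_walk i j k p q : path e (Phi i) (p ++ q) -> last (Phi i) (p ++ q) = Phi j ->
  size (p ++ q) = D i j -> last (Phi i) p = Phi k -> p != [::] -> q != [::] -> between i j.
Proof.
rewrite cat_path last_cat size_cat => /andP[pp pq] + pqD pk p0 q0.
rewrite pk in pq * => ql.
have Dik := walk_ge pp pk; have Dkj := walk_ge pq ql; have := dist_triangle i j k.
have sp : 0 < size p by rewrite lt0n size_eq0.
have sq : 0 < size q by rewrite lt0n size_eq0.
move=> tri; apply/existsP; exists k; apply/and3P; split; last by apply/eqP; lia.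
  by apply/negP => /eqP ki; move: tri pqD Dkj; rewrite ki; lia.
by apply/negP => /eqP kj; move: pqD Dik; rewrite kj; lia.
Qed.

Definition extras : seq 'I_N := enum [predC codom Phi].

Lemma size_extras : size extras <= 2.
Proof.
have [_ [Pinj _]] := real.
have H : #|codom Phi| + #|[predC codom Phi]| = #|'I_N|.
  by rewrite -(cardC [in codom Phi]); congr (_ + _); apply: eq_card.
by move: H; rewrite card_codom // !card_ord => H; rewrite /extras -cardE -(leq_add2l n) H.
Qed.

(** A list with at most one element, because the graph may have fewer than two extra vertices. *)
Definition hub_of (g : bool) : seq 'I_N := if g then drop 1 extras else take 1 extras.

Lemma hub_of_uniq g u v : u \in hub_of g -> v \in hub_of g -> u = v.
Proof.
have := size_extras; rewrite /hub_of; case: extras => [|a [|b [|//]]] _; case: g => //=;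
  by rewrite !inE => /eqP-> /eqP->.
Qed.

Lemma hub_ofP u : (forall k, u <> Phi k) -> exists g, u \in hub_of g.
Proof.
move=> uP; have : u \in extras.
  by rewrite mem_enum inE; apply/negP => /codomP[k /uP].
rewrite -[extras](cat_take_drop 1) mem_cat => /orP[H|H]; [by exists false | by exists true].
Qed.

Definition near (g : bool) (i : 'I_n) : bool := has (e (Phi i)) (hub_of g).

(** Otherwise the first three inner vertices of a shortest walk are all extra. Consecutive ones
    differ, so with two extra vertices the first equals the third, and cutting out the detour
    shortens the walk. *)
Lemma long_between i j : 3 < D i j -> between i j.
Proof.
have [[es ei] _] := real.
move=> D3; have [p [pD pp pl]] := walk_shortest i j.
have [//|/negP nb] := boolP (between i j); exfalso.
case: p pD pp pl D3 => [|a [|b [|c p]]] pD pp pl D3; try by rewrite -pD in D3.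
have p0 : p != [::] by apply/eqP => p0; rewrite -pD p0 in D3.
have term (v : 'I_N) q r : a :: b :: c :: p = q ++ r -> last (Phi i) q = v -> q != [::] ->
    r != [::] -> forall k, v <> Phi k.
  move=> E lq q0 r0 k vk; apply: nb.
  by apply: (@between_walk i j k q r); rewrite -?E ?lq.
have [ga aG] := hub_ofP (term a [:: a] (b :: c :: p) erefl erefl isT isT).
have [gb bG] := hub_ofP (term b [:: a; b] (c :: p) erefl erefl isT isT).
have [gc cG] := hub_ofP (term c [:: a; b; c] p erefl erefl isT p0).
move: pp => /=; move=> /and4P[ia ab bc cp].
have gab : ga != gb by apply/eqP => E; move: ab; rewrite -E in bG; rewrite (hub_of_uniq aG bG) ei.
have gbc : gb != gc by apply/eqP => E; move: bc; rewrite -E in cG; rewrite (hub_of_uniq bG cG) ei.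
have gE : ga = gc by case: (ga) (gb) (gc) gab gbc => [] [] [].
rewrite gE in aG; have acE := hub_of_uniq aG cG.
have := @walk_ge i j (a :: p); rewrite /= ia acE cp => /(_ isT pl); rewrite -pD /= => H; clear -H; lia.
Qed.

Lemma near_walk i u g : u \in hub_of g -> e (Phi i) u -> near g i.
Proof. by move=> uG iu; apply/hasP; exists u. Qed.

Lemma critical_hubs3 i j : critical 3 i j ->
  exists g u v, [/\ u \in hub_of g, v \in hub_of (~~ g), e (Phi i) u, e u v & e v (Phi j)].
Proof.
have [[es ei] _] := real.
move=> /andP[/eqP D3 nb]; have [p [pD pp pl]] := walk_shortest i j.
case: p pD pp pl => [|u [|v [|w [|? ?]]]]; rewrite D3 //= => pD /and4P[iu uv vw _] wj.
have U k : u <> Phi k.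
  move=> uk; move/negP: nb; apply.
  by apply: (@between_walk i j k [:: u] [:: v; w]); rewrite ?D3 //= iu uv vw.
have V k : v <> Phi k.
  move=> vk; move/negP: nb; apply.
  by apply: (@between_walk i j k [:: u; v] [:: w]); rewrite ?D3 //= iu uv vw.
have [g uG] := hub_ofP U; have [h vG] := hub_ofP V.
have gh : g != h by apply/eqP => E; move: uv; rewrite -E in vG; rewrite (hub_of_uniq uG vG) ei.
exists g, u, v; have <- : h = ~~ g by case: (g) (h) gh => [] [].
by rewrite -wj.
Qed.

Lemma near_grouping : grouping near.
Proof.
have [[es ei] _] := real; split.
- move=> g i j /hasP[u uG iu] /hasP[v vG jv]; rewrite (hub_of_uniq vG uG) in jv.
  by apply: (@walk_ge i j [:: u; Phi j]) => //=; rewrite iu es jv.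
(* The critical pair only provides the edge between the two extra vertices. As a hub is at most one
   vertex, [u] and [v] are the ends of this edge in one of the two orders. *)
- move=> /existsP[i0 /existsP[j0 /critical_hubs3[g0 [u0 [v0 [uG0 vG0 _ uv0 _]]]]]] g i j.
  move=> /hasP[u uG iu] /hasP[v vG jv].
  suff uv : e u v by apply: (@walk_ge i j [:: u; v; Phi j]) => //=; rewrite iu uv es jv.
  have [gE|gE] : g = g0 \/ g = ~~ g0 by case: (g) (g0) => [] []; auto.
    rewrite gE in uG vG; by rewrite (hub_of_uniq uG uG0) (hub_of_uniq vG vG0).
  rewrite gE ?negbK in uG vG; by rewrite (hub_of_uniq uG vG0) (hub_of_uniq vG uG0) es.
- move=> i j /andP[/eqP D2 nb]; have [p [pD pp pl]] := walk_shortest i j.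
  case: p pD pp pl => [|u [|w [|? ?]]]; rewrite D2 //= => pD /and3P[iu uw _] wj.
  have U k : u <> Phi k.
    move=> uk; move/negP: nb; apply.
    by apply: (@between_walk i j k [:: u] [:: w]); rewrite ?D2 //= iu uw.
  have [g uG] := hub_ofP U; exists g.
  by rewrite (near_walk uG iu) (near_walk uG) // es -wj.
- move=> i j /critical_hubs3[g [u [v [uG vG iu uv vj]]]]; exists g.
  by rewrite (near_walk uG iu) (near_walk vG) // es.
Qed.

(** A walk without repeated vertices visits at most [n + 2] vertices and thus has at most [n + 1]
    edges. *)
Lemma dist_bound i j : D i j <= n.+1.
Proof.
have [p [pD pp pl]] := walk_shortest i j.
move: pl; case/shortenP: pp => q qp qu _ ql.
have : size (Phi i :: q) <= N by rewrite -(card_uniqP qu) -[leqRHS]card_ord max_card.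
have /= := walk_ge qp ql; lia.
Qed.
End Necessary.

Theorem CombDMR2_necessary : CombDMR 2 D ->
  [/\ admissible, exists A, grouping A & forall i j, D i j <= n.+1].
Proof.
move=> [N [e [Phi [real Nn]]]]; split.
- split; [exact: dist_symm real | exact: dist_zero real | exact: dist_triangle real |].
  exact: long_between real Nn.
- by exists (near e Phi); apply: near_grouping.
- exact: dist_bound real Nn.
Qed.
End Characterisation.

(** * 2-SAT by unit propagation *)

Section TwoSat.
Variables (L : finType) (neg : L -> L) (cl : rel L).
Hypothesis negK : involutive neg.
Hypothesis cl_sym : symmetric cl.

(** [cl l l'] stands for the clause with the literals [l] and [l']. A true [l] falsifies [neg l], so
    a clause containing [neg l] forces its other literal. *)
Definition unit_step (X : {set L}) : {set L} :=
  X :|: [set l' | [exists l, (l \in X) && cl (neg l) l']].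

Definition closed_lits (X : {set L}) : Prop :=
  forall l l', l \in X -> cl (neg l) l' -> l' \in X.

Definition consistent (X : {set L}) : bool :=
  [forall l, ~~ ((l \in X) && (neg l \in X))].

Definition sat_model (X : {set L}) : Prop :=
  (forall l, (neg l \in X) = (l \notin X)) /\
  (forall l l', cl l l' -> (l \in X) || (l' \in X)).

(** Earlier choices are never revised, as [extend_model] justifies. The second alternative is taken
    unchecked: a conflict there persists and is detected by a single consistency test at the end. *)
Definition try_lit (k : nat) (X : {set L}) (v : L) : {set L} :=
  let Y := iter k unit_step (v |: X) in
  if consistent Y then Y else iter k unit_step (neg v |: X).

Definition two_sat (k : nat) (vs : seq L) : {set L} := foldl (try_lit k) set0 vs.

Lemma unit_step_sub (X : {set L}) : X \subset unit_step X.
Proof. exact: subsetUl. Qed.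

Lemma iter_unit_step_sub k (X : {set L}) : X \subset iter k unit_step X.
Proof. by elim: k => //= k IH; apply: subset_trans IH (unit_step_sub _). Qed.

Lemma unit_step_closed X : unit_step X = X -> closed_lits X.
Proof.
move=> XE l l' lX c; rewrite -XE !inE; apply/orP; right.
by apply/existsP; exists l; rewrite lX c.
Qed.

(** Every round adds a literal or changes nothing from then on, so [#|L|] rounds reach the
    fixpoint. *)
Lemma iter_unit_step_fix k (X : {set L}) : #|L| <= k -> unit_step (iter k unit_step X) = iter k unit_step X.
Proof.
move=> Lk; set Y := iter k unit_step X.
have H m : unit_step (iter m unit_step X) = iter m unit_step X \/ m <= #|iter m unit_step X|.
  elim: m => [|m [IH|IH]]; [by right | by left; rewrite /= !IH |].
  have [e|ne] := eqVneq (unit_step (iter m unit_step X)) (iter m unit_step X).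
    by left; rewrite /= !e.
  right; apply: leq_ltn_trans IH _; apply: proper_card.
  by rewrite properEneq eq_sym ne unit_step_sub.
case: (H k) => // kY; apply/eqP; rewrite eqEsubset unit_step_sub andbT.
have -> : Y = setT; last exact: subsetT.
by apply/eqP; rewrite eqEcard subsetT cardsT (leq_trans Lk).
Qed.

Lemma iter_unit_step_closed k X : #|L| <= k -> closed_lits (iter k unit_step X).
Proof. by move=> Lk; apply: unit_step_closed; apply: iter_unit_step_fix. Qed.

Lemma iter_unit_step_model k (X Z : {set L}) : sat_model Z -> X \subset Z -> iter k unit_step X \subset Z.
Proof.
move=> [Zn Zc] XZ; elim: k => //= k /subsetP IH; apply/subsetP => l'.
rewrite inE => /orP[/IH//|]; rewrite inE => /existsP[l /andP[/IH lZ /Zc]].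
by rewrite Zn lZ.
Qed.

Lemma model_consistent (Y Z : {set L}) : sat_model Z -> Y \subset Z -> consistent Y.
Proof.
move=> [Zn _] /subsetP YZ; apply/forallP => l; apply/negP => /andP[/YZ lZ /YZ].
by rewrite Zn lZ.
Qed.

(* A clause without a literal decided by X is still satisfied as in Z; otherwise X
   itself satisfies it, by closure. *)
Lemma extend_model X Z : closed_lits X -> consistent X -> sat_model Z ->
  exists2 Z', sat_model Z' & X \subset Z'.
Proof.
move=> Xc /forallP Xn [Zn Zc].
exists [set l | (l \in X) || ((neg l \notin X) && (l \in Z))]; last first.
  by apply/subsetP => l lX; rewrite inE lX.
split=> [l|l l' c]; rewrite !inE.
  rewrite negK Zn; have := Xn l; have := Xn (neg l); rewrite negK.
  by case: (l \in X); case: (neg l \in X); case: (l \in Z).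
case lX: (l \in X) => //=; case l'X: (l' \in X); rewrite ?orbT //=.
have nlX : neg l \notin X.
  by apply/negP => h; move: l'X; rewrite (Xc _ _ h) // negK.
have nl'X : neg l' \notin X.
  by apply/negP => h; move: lX; rewrite (Xc _ _ h) // negK cl_sym.
by rewrite nlX nl'X /=; apply: Zc.
Qed.

Lemma try_lit_sub k (X : {set L}) v : X \subset try_lit k X v.
Proof.
by rewrite /try_lit; case: ifP => _; apply: subset_trans (iter_unit_step_sub _ _);
  apply: subsetUr.
Qed.

Lemma try_lit_decides k X v : (v \in try_lit k X v) || (neg v \in try_lit k X v).
Proof.
rewrite /try_lit; case: ifP => _; apply/orP; [left|right];
  by apply: (subsetP (iter_unit_step_sub _ _)); rewrite setU11.
Qed.

Lemma try_lit_closed k X v : #|L| <= k -> closed_lits (try_lit k X v).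
Proof. by move=> Lk; rewrite /try_lit; case: ifP => _; apply: iter_unit_step_closed. Qed.

Lemma two_sat_closed k vs : #|L| <= k -> closed_lits (two_sat k vs).
Proof.
move=> Lk; rewrite /two_sat; elim/last_ind: vs => [|vs v _].
  by move=> l l'; rewrite inE.
by rewrite -cats1 foldl_cat; apply: try_lit_closed.
Qed.

Lemma two_sat_decides k vs v : v \in vs -> (v \in two_sat k vs) || (neg v \in two_sat k vs).
Proof.
rewrite /two_sat; elim/last_ind: vs => // vs w IH.
rewrite -cats1 foldl_cat mem_cat inE /= => /orP[/IH|/eqP->]; last exact: try_lit_decides.
by case/orP => h; apply/orP; [left|right]; apply: (subsetP (try_lit_sub _ _ _)).
Qed.

(** Consistency together with a decision for every variable makes [neg] the complement; closure then
    supplies the second literal of any clause whose first one is false. *)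
Theorem two_sat_sound k vs : #|L| <= k -> (forall l, (l \in vs) || (neg l \in vs)) ->
  consistent (two_sat k vs) -> sat_model (two_sat k vs).
Proof.
move=> Lk vsT cons.
have total l : (neg l \in two_sat k vs) = (l \notin two_sat k vs).
  have tot : (l \in two_sat k vs) || (neg l \in two_sat k vs).
    by have /orP[/two_sat_decides->//|/two_sat_decides] := vsT l; rewrite negK orbC; apply.
  by move: tot; have /forallP /(_ l) := cons; do 2!case: (_ \in _).
split=> // l l' c; case lX: (l \in two_sat k vs) => //=.
have nlX : neg l \in two_sat k vs by rewrite total lX.
by apply: (two_sat_closed Lk nlX); rewrite negK.
Qed.

(** A consistent closed set lies in some model [Z']. If assuming [v] leads to a conflict, then [v]
    is not in [Z'], so [neg v] is, and everything propagated from it stays within [Z']. *)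
Theorem two_sat_complete k vs Z : #|L| <= k -> sat_model Z -> consistent (two_sat k vs).
Proof.
move=> Lk Zm; rewrite /two_sat; elim/last_ind: vs => [|vs v IH].
  by apply/forallP => l; rewrite inE.
rewrite -cats1 foldl_cat /= -/(two_sat k vs) in IH *.
have [Z' Zm' XZ] := extend_model (two_sat_closed Lk (vs := vs)) IH Zm.
rewrite /try_lit; case: ifP => // /negbT vbad.
have vZ : v \notin Z'.
  apply/negP => vZ; move/negP: vbad; apply; apply: (model_consistent Zm').
  by apply: iter_unit_step_model => //; rewrite subUset sub1set vZ.
apply: (model_consistent Zm'); apply: iter_unit_step_model => //.
by have [Zn _] := Zm'; rewrite subUset sub1set Zn vZ.
Qed.
End TwoSat.

(** * Groupings as models of a 2-SAT instance *)

Section Encoding.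
Variables (n : nat) (D : 'I_n -> 'I_n -> nat).
Hypothesis Dok : admissible D.

(** [(g, s, x)] says that terminal [x] is joined to hub [g] when [s] is true, and that it is not
    when [s] is false. *)
Definition lit : finType := (bool * bool * 'I_n)%type.
Definition lneg (l : lit) : lit := (l.1.1, ~~ l.1.2, l.2).

Definition in_critical (x : 'I_n) : bool := [exists z, critical D 2 x z || critical D 3 x z].

(** For a critical pair at distance 2, distributing (a_x and a_y) or (b_x and b_y) gives a_x or b_y,
    b_x or a_y, a_x or b_x, a_y or b_y. At distance 3 the first two become a_x or a_y, b_x or b_y.
    The last two concern one terminal each and are common to both cases, which is the purpose of
    [in_critical]. No clause mixes signs, so one [s] suffices. *)
Definition clause (s g : bool) (x : 'I_n) (h : bool) (y : 'I_n) : bool :=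
  if s then
    if g == h then critical D 3 x y
    else critical D 2 x y || (x == y) && in_critical x
  else if g == h then 2 < D x y else hub_edge D && (3 < D x y).

Definition lclause : rel lit :=
  fun l l' => (l.1.2 == l'.1.2) && clause l.1.2 l.1.1 l.2 l'.1.1 l'.2.

Lemma lnegK : involutive lneg.
Proof. by move=> [[g s] x]; rewrite /lneg /= negbK. Qed.

Lemma between_sym i j : between D i j = between D j i.
Proof.
have [Ds _ _ _] := Dok.
by apply: eq_existsb => k; rewrite andbCA (Ds i j) (Ds i k) (Ds k j) addnC.
Qed.

Lemma critical_sym d i j : critical D d i j = critical D d j i.
Proof. by have [Ds _ _ _] := Dok; rewrite /critical between_sym Ds. Qed.

Lemma lclause_sym : symmetric lclause.
Proof.
have [Ds _ _ _] := Dok.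
move=> [[g s] x] [[h t] y]; rewrite /lclause /clause /= eq_sym; case: eqP => //= <-.
rewrite (eq_sym h) (critical_sym 3 y) (critical_sym 2 y) (Ds y) (eq_sym y).
by case: (x =P y) => [->|].
Qed.

Lemma model_grouping (Z : {set lit}) : sat_model lneg lclause Z ->
  grouping D (fun g x => (g, true, x) \in Z).
Proof.
move=> [Zn Zc].
have Zf g x : ((g, false, x) \in Z) = ((g, true, x) \notin Z) by rewrite -Zn.
have pos g x h y : clause true g x h y -> ((g, true, x) \in Z) || ((h, true, y) \in Z).
  by move=> c; apply: Zc; rewrite /lclause /=.
have opp g x h y : clause false g x h y -> ((g, true, x) \notin Z) || ((h, true, y) \notin Z).
  by move=> c; rewrite -!Zf; apply: Zc; rewrite /lclause /=.
have inc d i j : (d == 2) || (d == 3) -> critical D d i j -> in_critical i.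
  by move=> dE c; apply/existsP; exists j; case/orP: dE => /eqP <-; rewrite c ?orbT.
split.
- move=> g i j gi gj; rewrite leqNgt; apply/negP => D2.
  by have := opp g i g j; rewrite /clause eqxx D2 gi gj => /(_ isT).
- move=> ab g i j gi gj; rewrite leqNgt; apply/negP => D3.
  by have := opp g i (~~ g) j; rewrite /clause ab D3 gi gj; case: (g) => /(_ isT).
- move=> i j c.
  have ii := inc 2 i j isT c; have jj : in_critical j by apply: (inc 2 j i); rewrite // critical_sym.
  have := pos false i true i; have := pos false j true j.
  have := pos false i true j; have := pos true i false j.
  rewrite /clause /= !eqxx ii jj c ?andbT !orbT => /(_ isT) a1 /(_ isT) a2 /(_ isT) a3 /(_ isT) a4.
  case: (boolP ((false, true, i) \in Z)) a2 a4 => [fi _ _|_ /= tj ti]; last by exists true; rewrite ti tj.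
  case: (boolP ((false, true, j) \in Z)) a1 a3 => [fj _ _|_]; first by exists false; rewrite fi fj.
  by rewrite orbF /= => ti tj; exists true; rewrite ti tj.
- move=> i j c.
  have ii := inc 3 i j isT c; have jj : in_critical j by apply: (inc 3 j i); rewrite // critical_sym.
  have := pos false i true i; have := pos false j true j.
  have := pos false i false j; have := pos true i true j.
  rewrite /clause /= !eqxx ii jj c ?andbT !orbT => /(_ isT) a1 /(_ isT) a2 /(_ isT) a3 /(_ isT) a4.
  case: (boolP ((false, true, i) \in Z)) a2 a4 => [fi _ _|_ /= fj ti]; last by exists true; rewrite ti fj.
  case: (boolP ((true, true, j) \in Z)) a1 a3 => [tj _ _|_]; first by exists false; rewrite fi tj.
  by rewrite !orbF /= => ti fj; exists true; rewrite ti fj.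
Qed.

Lemma grouping_model A : grouping D A ->
  sat_model lneg lclause [set l : lit | A l.1.1 l.2 == l.1.2].
Proof.
move=> [A2 A3 C2 C3]; split.
  by move=> [[g s] x]; rewrite !inE /=; case: (A g x); case: s.
have C2' x y : critical D 2 x y -> forall g, A g x || A (~~ g) y.
  by move=> /C2[[] /andP[/= hx hy]] [] /=; rewrite ?hx ?hy ?orbT.
have C3' x y : critical D 3 x y -> forall g, A g x || A g y.
  by move=> /C3[[] /andP[/= hx hy]] [] /=; rewrite ?hx ?hy ?orbT.
move=> [[g s] x] [[h t] y]; rewrite !inE /lclause /clause /= => /andP[/eqP<-].
case: s; case: (eqVneq g h) => [<-|gh].
- by rewrite !eqb_id; move/C3'; apply.
- have -> : h = ~~ g by case: (g) (h) gh => [] [].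
  rewrite !eqb_id => /orP[/C2'//|/andP[/eqP<- /existsP[z /orP[/C2|/C3]]]] [k /andP[kx _]];
    by case: (g) (k) kx => [] [] ->; rewrite ?orbT.
- move=> D2; rewrite !eqbF_neg -negb_and; apply/negP => /andP[gx gy].
  by have := A2 _ _ _ gx gy; lia.
- move=> /andP[ab D3]; rewrite !eqbF_neg -negb_and; apply/negP => /andP[gx hy].
  have hE : h = ~~ g by case: (g) (h) gh => [] [].
  by rewrite hE in hy; have := A3 ab _ _ _ gx hy; lia.
Qed.
End Encoding.

(** * Reading the input *)

(* Variables are numbered: 0 holds n, 1 to 19 are used by the formulas and
   commands, and the macros bind 20 and above, so that they capture nothing. *)
Definition num (k : nat) : expr := iter k Succ Zero.
Definition Not (e : expr) : expr := Ite e Zero (num 1).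
Definition And (a b : expr) : expr := Ite a b Zero.
Definition Or (a b : expr) : expr := Ite a (num 1) b.
Definition Ex (x : nat) (b : expr) : expr := Fold 50 x Zero (Ite (Var 50) (num 1) b).
Definition Exn (x : nat) (b : expr) : expr := Ex x (And (Lt (Var x) (Var 0)) b).
Definition Count (x : nat) (b : expr) : expr := Fold 60 x Zero (Ite b (Succ (Var 60)) (Var 60)).

Definition seps_before (q : nat) : expr := Count 61 (And (Lt (Var 61) (Var q)) (Mem 1 (Var 61))).
Definition seps : expr := Count 61 (Mem 1 (Var 61)).

(* The value of the word number [Var 20] of the input, by Horner's rule: words
   are written least significant bit first, so the tape is read backwards. *)
Definition decode : expr :=
  Fold 21 22 Zero (Let 23 (Count 25 (Lt (Var 22) (Var 25)))
    (Ite (And (Eq (seps_before 23) (Var 20)) (Not (Mem 1 (Var 23))))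
         (Add (Add (Var 21) (Var 21)) (Mem 0 (Var 23))) (Var 21))).

Definition Dv (i j : nat) : expr := Let 20 (Add (Mul (Var i) (Var 0)) (Var j)) decode.

Definition between_e (i j : nat) : expr :=
  Exn 5 (And (Not (Eq (Var 5) (Var i))) (And (Not (Eq (Var 5) (Var j)))
    (Eq (Add (Dv i 5) (Dv 5 j)) (Dv i j)))).
Definition critical_e (d i j : nat) : expr := And (Eq (Dv i j) (num d)) (Not (between_e i j)).
Definition hub_edge_e : expr := Exn 1 (Exn 2 (critical_e 3 1 2)).
(** The first disjunct detects a saturated entry, the cap being the only value fixed by [Succ]; the
    others negate the conditions of [admissible]. *)
Definition bad_e : expr :=
  Exn 1 (Exn 2 (Or (Eq (Dv 1 2) (Succ (Dv 1 2)))
    (Or (Not (Eq (Dv 1 2) (Dv 2 1)))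
    (Or (Not (Eq (Eq (Dv 1 2) Zero) (Eq (Var 1) (Var 2))))
    (Or (Exn 5 (Lt (Add (Dv 1 5) (Dv 5 2)) (Dv 1 2)))
        (And (Lt (num 3) (Dv 1 2)) (Not (between_e 1 2)))))))).
Definition in_critical_e (x : nat) : expr := Exn 6 (Or (critical_e 2 x 6) (critical_e 3 x 6)).
Definition clause_e (s g : bool) (x : nat) (h : bool) (y : nat) : expr :=
  if s then
    if g == h then critical_e 3 x y
    else Or (critical_e 2 x y) (And (Eq (Var x) (Var y)) (in_critical_e x))
  else if g == h then Lt (num 2) (Dv x y) else And hub_edge_e (Lt (num 3) (Dv x y)).

Definition is_sep (a : sym) : bool := if a is Sep then true else false.
Definition is_one (a : sym) : bool := if a is Defs.S1 then true else false.

Definition horner (u : seq sym) : nat := foldr (fun a v => v + v + is_one a) 0 u.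

Lemma horner_bin m : horner (bin m) = m.
Proof.
suff H f k : k <= f -> horner (bin_fuel f k) = k by apply: H.
elim: f k => [|f IH] k kf /=; first by case: k kf.
case: eqP => [->//|k0]; have kE := odd_double_half k; rewrite -muln2 in kE.
by rewrite /= -/(horner _) IH; [case: odd kE => /= | ]; lia.
Qed.

Lemma bin_sep m : count is_sep (bin m) = 0.
Proof.
rewrite /bin; move: {1}m => f; elim: f m => //= f IH m.
by case: eqP => //= _; rewrite IH; case: odd.
Qed.

Definition enc_words (ws : seq nat) : seq sym := flatten [seq bin w ++ [:: Sep] | w <- ws].

Lemma enc_words_seps ws : count is_sep (enc_words ws) = size ws.
Proof.
by elim: ws => //= w ws IH; rewrite /enc_words /= !count_cat bin_sep IH.
Qed.

(** A non-empty encoding ends with a separator, which every proper prefix misses. *)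
Lemma enc_words_prefix ws q : q < size (enc_words ws) ->
  count is_sep (take q (enc_words ws)) < size ws.
Proof.
elim/last_ind: ws => // ws w _.
rewrite /enc_words -cats1 map_cat flatten_cat /= cats0 -/(enc_words ws) catA.
rewrite [in size (_ ++ _)]size_cat addn1 ltnS => qs.
rewrite takel_cat // size_cat addn1 ltnS.
rewrite -[leqRHS]addn0 -(bin_sep w) -enc_words_seps -count_cat -[in leqRHS](cat_take_drop q (_ ++ bin w)).
by rewrite [leqRHS]count_cat leq_addr.
Qed.

Section Eval.
Variable S : nat.
Hypothesis S4 : 4 <= S.

Definition bv (M : memory) (env : nat -> nat) (e : expr) : bool := ev S M env e != 0.

Lemma ev_num M env k : ev S M env (num k) = minn S.-1 k.
Proof. by elim: k => [|k IH] /=; [lia | rewrite IH; lia]. Qed.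

Lemma ev_Var M env y : ev S M env (Var y) = env y. Proof. by []. Qed.

Lemma ev_Ite M env b e1 e2 :
  ev S M env (Ite b e1 e2) = if bv M env b then ev S M env e1 else ev S M env e2.
Proof. by []. Qed.

Lemma ev_Let M env y e1 e2 :
  ev S M env (Let y e1 e2) = ev S M (upd env y (ev S M env e1)) e2.
Proof. by []. Qed.

Lemma ev_Add M env e1 e2 :
  ev S M env (Add e1 e2) = minn S.-1 (ev S M env e1 + ev S M env e2).
Proof. by []. Qed.

Lemma ev_Mem M env m e : ev S M env (Mem m e) = M m (ev S M env e).
Proof. by []. Qed.

Lemma ev_Fold M env a y e0 e : ev S M env (Fold a y e0 e) =
  foldl (fun v p => ev S M (upd (upd env a v) y p) e) (ev S M env e0) (iota 0 S).
Proof. by []. Qed.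

Lemma bv_Ite M env b e1 e2 :
  bv M env (Ite b e1 e2) = if bv M env b then bv M env e1 else bv M env e2.
Proof. by rewrite [LHS]/bv ev_Ite; case: (bv M env b). Qed.

Lemma bv_Not M env e : bv M env (Not e) = ~~ bv M env e.
Proof. by rewrite /bv /=; case: (eqVneq (ev S M env e) 0) => //= _; lia. Qed.

Lemma bv_And M env a b : bv M env (And a b) = bv M env a && bv M env b.
Proof. by rewrite /bv /=; case: (eqVneq (ev S M env a) 0). Qed.

Lemma bv_Or M env a b : bv M env (Or a b) = bv M env a || bv M env b.
Proof. by rewrite /bv /=; case: (eqVneq (ev S M env a) 0) => //= _; lia. Qed.

Lemma bv_Eq M env a b : bv M env (Eq a b) = (ev S M env a == ev S M env b).
Proof. by rewrite /bv /=; case: (_ == ev S M env b). Qed.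

Lemma bv_Lt M env a b : bv M env (Lt a b) = (ev S M env a < ev S M env b).
Proof. by rewrite /bv /=; case: (_ < ev S M env b). Qed.

Lemma bv_Mem M env m e : bv M env (Mem m e) = M m (ev S M env e).
Proof. by rewrite /bv /=; case: (M m _). Qed.

Lemma bv_Ex M env x b : x != 50 ->
  bv M env (Ex x b) = has (fun p => bv M (upd (upd env 50 0) x p) b) (iota 0 S).
Proof.
move=> x50; rewrite /bv /Ex; set e := Ite _ _ _ => /=; set f := fun v p => _.
have fE v p : (f v p != 0) = (v != 0) || (ev S M (upd (upd env 50 0) x p) b != 0).
  rewrite /f /e /= upd_neq ?upd_eq; last by rewrite eq_sym.
  by case: (eqVneq v 0) => [->|] //= v0; lia.
suff H v s : (foldl f v s != 0) = (v != 0) || has (fun p => ev S M (upd (upd env 50 0) x p) b != 0) s.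
  by rewrite H.
by elim: s v => [|p s IH] v /=; rewrite ?orbF // IH fE orbA.
Qed.

Lemma has_ord n (P : nat -> bool) : n <= S ->
  has (fun p => (p < n) && P p) (iota 0 S) = [exists i : 'I_n, P i].
Proof.
move=> nS; apply/hasP/existsP => [[p _ /andP[pn Pp]]|[i Pi]]; first by exists (Ordinal pn).
by exists (val i); rewrite ?mem_iota ?ltn_ord //=; have := ltn_ord i; lia.
Qed.

Lemma bv_Exn n M env x b (Q : 'I_n -> bool) : n <= S -> env 0 = n -> x != 0 -> x != 50 ->
  (forall i : 'I_n, bv M (upd (upd env 50 0) x i) b = Q i) ->
  bv M env (Exn x b) = [exists i, Q i].
Proof.
move=> nS e0 x0 x50 bQ; rewrite /Exn bv_Ex //.
transitivity [exists i : 'I_n, bv M (upd (upd env 50 0) x i) b]; last exact: eq_existsb.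
rewrite -(@has_ord n (fun p => bv M (upd (upd env 50 0) x p) b)) //.
by apply: eq_has => p; rewrite bv_And bv_Lt /= upd_eq upd_neq 1?eq_sym // upd_neq // e0.
Qed.

Lemma ev_Count M env x b P : x != 60 ->
  (forall v p, bv M (upd (upd env 60 v) x p) b = P p) ->
  ev S M env (Count x b) = minn S.-1 (count P (iota 0 S)).
Proof.
move=> x60 bP; rewrite /Count /=.
suff H v s : v <= S.-1 ->
   foldl (fun v p => if ev S M (upd (upd env 60 v) x p) b != 0
      then minn S.-1 (upd (upd env 60 v) x p 60).+1 else upd (upd env 60 v) x p 60) v s =
   minn S.-1 (v + count P s) by rewrite H.
elim: s v => [|p s IH] v vS /=; first by lia.
rewrite -/(bv _ _ _) bP upd_neq 1?eq_sym // upd_eq IH; last by case: ifP => //; lia.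
by case: (P p) => /=; lia.
Qed.

Lemma count_nth_iota (bs : seq bool) q : count (nth false bs) (iota 0 q) = count id (take q bs).
Proof.
elim: q => [|q IH]; first by rewrite take0.
rewrite -addn1 iotaD count_cat IH /= add0n addn0 addn1.
case: (ltnP q (size bs)) => qb; first by rewrite (take_nth false) // -cats1 count_cat /= addn0.
by rewrite nth_default // !take_oversize ?addn0 //; lia.
Qed.

Lemma map_sub_iota : [seq S.-1 - p | p <- iota 0 S] = rev (iota 0 S).
Proof.
apply: (@eq_from_nth _ 0); rewrite size_map ?size_rev // size_iota => p pS.
rewrite (nth_map 0) ?size_iota // nth_rev ?size_iota // !nth_iota //; lia.
Qed.

Lemma eq_in_foldl (A : Type) (B : eqType) (f g : A -> B -> A) v (s : seq B) :
  (forall v p, p \in s -> f v p = g v p) -> foldl f v s = foldl g v s.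
Proof.
elim: s v => //= p s IH v H; rewrite H ?mem_head // IH // => w q qs.
by apply: H; rewrite inE qs orbT.
Qed.

Lemma eq_in_foldr (A : Type) (B : eqType) (f g : B -> A -> A) v (s : seq B) :
  (forall p v, p \in s -> f p v = g p v) -> foldr f v s = foldr g v s.
Proof.
elim: s => //= p s IH H; rewrite IH ?H ?mem_head // => q w qs.
by apply: H; rewrite inE qs orbT.
Qed.

Lemma foldl_map (A B C : Type) (f : A -> B -> A) (h : C -> B) v s :
  foldl f v (map h s) = foldl (fun v p => f v (h p)) v s.
Proof. by elim: s v => //= p s IH v. Qed.

Section Input.
Variable x : seq sym.
Hypothesis xS : S = size x + 4.

Definition holds_input (M : memory) : Prop :=
  forall p, M 0 p = nth false (map is_one x) p /\ M 1 p = nth false (map is_sep x) p.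

Lemma count_sep M q : holds_input M -> count (M 1) (iota 0 q) = count is_sep (take q x).
Proof.
move=> Mx; rewrite (eq_count (a2 := nth false (map is_sep x))); last by move=> p; case: (Mx p).
by rewrite count_nth_iota -map_take count_map.
Qed.

Lemma count_sep_small q : count is_sep (take q x) <= S.-1.
Proof. by apply: leq_trans (count_size _ _) _; rewrite size_take_min xS; lia. Qed.

Lemma ev_seps M env : holds_input M -> ev S M env seps = count is_sep x.
Proof.
move=> Mx; rewrite /seps (@ev_Count _ _ _ _ (M 1)) //; last by move=> v p; rewrite bv_Mem.
by rewrite count_sep // take_oversize; [have := count_size is_sep x|]; lia.
Qed.

Lemma ev_seps_before M env q : holds_input M -> q < 60 -> env q < S ->
  ev S M env (seps_before q) = count is_sep (take (env q) x).
Proof.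
move=> Mx q60 qS.
rewrite /seps_before (@ev_Count _ _ _ _ (fun p => (p < env q) && M 1 p)) //; last first.
  by move=> v p; rewrite bv_And bv_Lt bv_Mem /= !(upd_neq _ _ (y := q)) //; lia.
have -> : iota 0 S = iota 0 (env q) ++ iota (env q) (S - env q).
  by rewrite -iotaD subnKC // ltnW.
set P := fun p => _.
have Z : count P (iota (env q) (S - env q)) = 0.
  rewrite (eq_in_count (a2 := pred0)) ?count_pred0 // => p.
  by rewrite mem_iota /P => /andP[/leq_gtF->].
rewrite count_cat Z (eq_in_count (a2 := M 1)); last by rewrite /P => p; rewrite mem_iota => /= ->.
by rewrite count_sep // addn0; have := count_sep_small (env q); lia.
Qed.

Lemma ev_decode M env : holds_input M -> ev S M env decode =
  foldr (fun q v => if (count is_sep (take q x) == env 20) && ~~ M 1 q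
    then minn S.-1 (minn S.-1 (v + v) + M 0 q) else v) 0 (iota 0 S).
Proof.
move=> Mx; rewrite -foldl_rev -map_sub_iota /decode.
rewrite ev_Fold foldl_map; apply: eq_in_foldl => v p.
rewrite mem_iota => /andP[_ pS]; set env' := upd (upd env 21 v) 22 p.
(* The language has no subtraction: the mirrored position [S.-1 - p] is obtained as the number of
   positions beyond [p]. *)
have cE : ev S M env' (Count 25 (Lt (Var 22) (Var 25))) = S.-1 - p.
  rewrite (@ev_Count _ _ _ _ (fun y => p < y)) //; last by move=> w y; rewrite bv_Lt.
  have -> : iota 0 S = iota 0 p.+1 ++ iota p.+1 (S - p.+1) by rewrite -iotaD subnKC.
  rewrite count_cat (eq_in_count (a2 := pred0)); last first.
    by move=> y; rewrite mem_iota => /andP[_]; rewrite ltnS => /leq_gtF->.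
  rewrite count_pred0 (eq_in_count (a2 := predT)); last by move=> y; rewrite mem_iota => /andP[->].
  by rewrite count_predT size_iota; lia.
rewrite ev_Let cE ev_Ite bv_And bv_Eq bv_Not bv_Mem !ev_Add ev_Mem !ev_Var ev_seps_before //=.
by rewrite upd_eq; lia.
Qed.

Lemma foldr_id (A : eqType) (B : Type) (f : A -> B -> B) v s :
  (forall p w, p \in s -> f p w = w) -> foldr f v s = v.
Proof.
elim: s => //= p s IH H; rewrite IH ?H ?mem_head // => q w qs.
by apply: H; rewrite inE qs orbT.
Qed.

(** Capping every step amounts to capping the result, because doubling a capped value stays at the
    cap. *)
Lemma horner_sat (M : memory) a u :
  (forall k, k < size u -> M 0 (a + k) = is_one (nth S0 u k)) ->
  foldr (fun q v => minn S.-1 (minn S.-1 (v + v) + M 0 q)) 0 (iota a (size u)) =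
  minn S.-1 (horner u).
Proof.
elim: u a => [|b u IH] a H /=; first by lia.
rewrite (IH a.+1) => [|k ku]; last by rewrite addSnnS (H k.+1).
have := H 0; rewrite addn0 => -> //=; rewrite -/(horner u); case: (is_one b); lia.
Qed.

Lemma decode_correct M env ws : holds_input M -> x = enc_words ws -> env 20 < size ws ->
  ev S M env decode = minn S.-1 (nth 0 ws (env 20)).
Proof.
move=> Mx xE; set t := env 20 => tw; rewrite ev_decode // -/t.
set pre := enc_words (take t ws); set u := bin (nth 0 ws t).
set post := enc_words (drop t.+1 ws).
have xE' : x = pre ++ u ++ Sep :: post.
  by rewrite xE -{1}(cat_take_drop t ws) (drop_nth 0 tw) /enc_words map_cat flatten_cat /= -catA.
have tpre : count is_sep pre = t by rewrite enc_words_seps size_takel // ltnW.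
have usep : count is_sep u = 0 by apply: bin_sep.
(* Only the middle block contributes. Earlier positions have fewer than [t] separators before them
   and positions beyond the closing separator have more; the separator itself has exactly [t], but
   is excluded by the test of memory 1. *)
have iE : iota 0 S = iota 0 (size pre) ++ iota (size pre) (size u) ++
    iota (size pre + size u) (S - (size pre + size u)).
  by rewrite catA -!iotaD subnKC // xS xE' !size_cat /=; lia.
have M1 p : M 1 p = is_sep (nth S0 x p).
  have [_ ->] := Mx p; case: (ltnP p (size x)) => px; first by rewrite (nth_map S0).
  by rewrite !nth_default ?size_map.
have M0 p : M 0 p = is_one (nth S0 x p).
  have [-> _] := Mx p; case: (ltnP p (size x)) => px; first by rewrite (nth_map S0).
  by rewrite !nth_default ?size_map.
set f := fun q v => _; rewrite iE !foldr_cat.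
rewrite [foldr f 0 _]foldr_id; last first.
  move=> p w; rewrite mem_iota /f => /andP[p1 _]; case: (ltngtP (size pre + size u) p) p1 => // [p1|pE] _.
    have -> : (count is_sep (take p x) == t) = false.
      apply/eqP => E; move: p1; rewrite -size_cat => p1.
      have : count is_sep (take (size (pre ++ u)).+1 x) <= count is_sep (take p x).
        rewrite -(cat_take_drop (size (pre ++ u)).+1 (take p x)) take_takel // count_cat; lia.
      rewrite E xE' catA take_cat ltnNge leqnSn /= subSn // subnn /= take0.
      by rewrite !count_cat /= tpre usep; lia.
    by [].
  rewrite M1 -pE xE' catA nth_cat size_cat ltnn subnn /= andbF //.
have -> : foldr f 0 (iota (size pre) (size u)) = minn S.-1 (nth 0 ws t).
  rewrite -[in RHS](horner_bin (nth 0 ws t)) -/u -(@horner_sat M (size pre) u); last first.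
    by move=> k ku; rewrite M0 xE' nth_cat ltnNge leq_addr /= addKn nth_cat ku.
  apply: eq_in_foldr => p v; rewrite mem_iota /f => /andP[p1 p2].
  have [k kE] : exists k, p = size pre + k by exists (p - size pre); rewrite subnKC.
  have ku : k < size u by rewrite kE in p2; lia.
  rewrite M1 kE xE' nth_cat ltnNge leq_addr /= addKn nth_cat ku.
  rewrite take_cat ltnNge leq_addr /= addKn take_cat ku count_cat tpre.
  have u0 : all (predC is_sep) u by rewrite all_predC has_count usep.
  have -> : count is_sep (take k u) = 0.
    by have := usep; rewrite -{1}(cat_take_drop k u) count_cat; lia.
  have /= -> := all_nthP S0 u0 k ku.
  by rewrite addn0 eqxx /= -kE.
apply: foldr_id => p w; rewrite mem_iota /f add0n => /andP[_ pp].
have : count is_sep (take p x) < t.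
  rewrite xE' takel_cat; last exact: ltnW.
  rewrite -[ltnRHS](size_takel (ltnW tw)); exact: enc_words_prefix.
by move=> h; have -> : (count is_sep (take p x) == t) = false by lia.
Qed.
End Input.
End Eval.

Lemma nth_allpairs (A B : Type) (R : Type) (f : A -> B -> R) a0 b0 r0 s t i j :
  i < size s -> j < size t ->
  nth r0 [seq f a b | a <- s, b <- t] (i * size t + j) = f (nth a0 s i) (nth b0 t j).
Proof.
elim: s i => // a s IH [|i] /= iS jT; rewrite nth_cat size_map.
  by rewrite mul0n add0n jT (nth_map b0).
by rewrite mulSn -addnA ltnNge leq_addr /= addKn IH.
Qed.

(** * The formulas evaluated on an encoded matrix *)

Section MatrixEval.
Variables (n : nat) (D : 'I_n -> 'I_n -> nat).
Let x := enc_matrix D.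
Let S := size x + 4.

Definition entries : seq nat := [seq D i j | i <- enum 'I_n, j <- enum 'I_n].

Lemma enc_matrixE : enc_matrix D = enc_words entries.
Proof. by rewrite /enc_words /entries map_allpairs. Qed.

Lemma size_entries : size entries = n * n.
Proof. by rewrite size_allpairs size_enum_ord. Qed.

Lemma nth_entries (i j : 'I_n) : nth 0 entries (i * n + j) = D i j.
Proof.
have := @nth_allpairs _ _ _ D i i 0 (enum 'I_n) (enum 'I_n) i j.
by rewrite size_enum_ord !nth_ord_enum => ->.
Qed.

Lemma count_sep_matrix : count is_sep x = n * n.
Proof. by rewrite /x enc_matrixE enc_words_seps size_entries. Qed.

Lemma sqr_le_size : n * n + 4 <= S.
Proof. by rewrite leq_add2r -count_sep_matrix count_size. Qed.

Lemma S_ge4 : 4 <= S. Proof. by rewrite leq_addl. Qed.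

Lemma n_lt_S : n + 4 <= S.
Proof. by apply: leq_trans sqr_le_size; rewrite leq_add2r; case: (n) => // m; rewrite leq_pmulr. Qed.

(** This is [n * n - 4 * n + 4 >= 0], a square. It ensures that a loop over the tape has at least as
    many rounds as there are literals. *)
Lemma lits_le_S : 4 * n <= S.
Proof.
apply: leq_trans sqr_le_size.
have H k : 4 * k <= k * k + 4 by case: k => [|[|k]] //; rewrite mulSn mulSn mulnS mulnS; lia.
exact: H.
Qed.

Local Notation bv := (bv S).
Local Notation ev := (ev S).
Local Notation holds_input := (holds_input x).

Lemma ev_Dv M env i j (a b : 'I_n) : holds_input M -> env 0 = n -> env i = a -> env j = b ->
  ev M env (Dv i j) = minn S.-1 (D a b).
Proof.
move=> Mx e0 ei ej; rewrite /Dv ev_Let.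
have ab : a * n + b < n * n.
  have := ltn_ord a; have := ltn_ord b => bn an.
  by apply: (@leq_trans (a.+1 * n)); [rewrite mulSn; lia | rewrite leq_mul2r an orbT].
have nS := sqr_le_size.
have tE : ev M env (Add (Mul (Var i) (Var 0)) (Var j)) = a * n + b.
  by rewrite /= e0 ei ej; lia.
rewrite tE (@decode_correct _ S_ge4 x (erefl _) M _ entries) //.
- by rewrite upd_eq nth_entries.
- exact: enc_matrixE.
- by rewrite upd_eq size_entries.
Qed.

Section Exact.
Hypothesis Dsmall : forall i j, D i j < S.-1.
Variable M : memory.
Hypothesis Mx : holds_input M.

Lemma ev_Dv_exact env i j (a b : 'I_n) : env 0 = n -> env i = a -> env j = b ->
  ev M env (Dv i j) = D a b.
Proof. by move=> e0 ei ej; rewrite (ev_Dv Mx e0 ei ej); have := Dsmall a b; lia. Qed.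

Lemma nS : n <= S. Proof. by have := n_lt_S; lia. Qed.

(** The sum of two entries may still be capped, but then it evaluates to [S - 1], which no entry
    equals. *)
Lemma bv_between env i j (a b : 'I_n) : i \notin [:: 5; 50] -> j \notin [:: 5; 50] ->
  env 0 = n -> env i = a -> env j = b -> bv M env (between_e i j) = between D a b.
Proof.
rewrite !inE !negb_or => /andP[i5 i50] /andP[j5 j50] e0 ei ej.
have S4 := S_ge4; apply: (bv_Exn S4 nS e0) => // k.
set env' := upd _ _ _.
have e0' : env' 0 = n by [].
have ei' : env' i = a by rewrite /env' !upd_neq.
have ej' : env' j = b by rewrite /env' !upd_neq.
have ek' : env' 5 = k by [].
rewrite !bv_And // !bv_Not // !bv_Eq // ev_Add !ev_Var ei' ej' ek'.
rewrite (ev_Dv_exact e0' ei' ek') (ev_Dv_exact e0' ek' ej') (ev_Dv_exact e0' ei' ej').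
by rewrite !val_eqE; congr [&& _, _ & _]; have := Dsmall a b; lia.
Qed.

Lemma bv_critical env d i j (a b : 'I_n) : i \notin [:: 5; 50] -> j \notin [:: 5; 50] ->
  d <= 3 -> env 0 = n -> env i = a -> env j = b ->
  bv M env (critical_e d i j) = critical D d a b.
Proof.
have S4 := S_ge4; move=> i5 j5 d3 e0 ei ej; rewrite bv_And // bv_Not // bv_Eq // ev_num //.
rewrite (ev_Dv_exact e0 ei ej) (bv_between i5 j5 e0 ei ej) /critical.
by congr (_ && _); have := S_ge4; have := Dsmall a b; lia.
Qed.

Lemma bv_hub_edge env : env 0 = n -> bv M env hub_edge_e = hub_edge D.
Proof.
move=> e0; apply: (bv_Exn S_ge4 nS e0) => // i; apply: (bv_Exn S_ge4 nS) => // j.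
exact: bv_critical.
Qed.

Lemma bv_in_critical env y (a : 'I_n) : y \notin [:: 5; 6; 50] -> env 0 = n -> env y = a ->
  bv M env (in_critical_e y) = in_critical D a.
Proof.
rewrite !inE !negb_or => /and3P[y5 y6 y50] e0 ey.
have S4 := S_ge4; apply: (bv_Exn S4 nS e0) => // z; rewrite bv_Or //.
set env' := upd _ _ _.
have ey' : env' y = a by rewrite /env' !upd_neq.
have y' : y \notin [:: 5; 50] by rewrite !inE negb_or y5.
by rewrite !(@bv_critical env' _ y 6 a z).
Qed.

Lemma bv_clause env s g y h z (a b : 'I_n) : y \notin [:: 5; 6; 50] -> z \notin [:: 5; 6; 50] ->
  env 0 = n -> env y = a -> env z = b ->
  bv M env (clause_e s g y h z) = clause D s g a h b.
Proof.
move=> y6 z6 e0 ey ez.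
have y5 : y \notin [:: 5; 50] by move: y6; rewrite !inE !negb_or => /and3P[-> _ ->].
have z5 : z \notin [:: 5; 50] by move: z6; rewrite !inE !negb_or => /and3P[-> _ ->].
have S4 := S_ge4.
have cr d : d <= 3 -> bv M env (critical_e d y z) = critical D d a b.
  by move=> d3; apply: bv_critical.
rewrite /clause_e /clause; case: s; case: eqP => // _; rewrite ?cr //.
- by rewrite bv_Or // bv_And // cr // (bv_in_critical y6 e0 ey) bv_Eq // !ev_Var ey ez val_eqE.
- by rewrite bv_Lt // ev_num // (ev_Dv_exact e0 ey ez); congr (_ < _); lia.
- rewrite bv_And // bv_hub_edge // bv_Lt // ev_num // (ev_Dv_exact e0 ey ez).
  by congr (_ && (_ < _)); lia.
Qed.
End Exact.

Lemma bv_bad M env : holds_input M -> env 0 = n ->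
  ~~ bv M env bad_e <-> (forall i j, D i j < S.-1) /\ admissible D.
Proof.
move=> Mx e0; have S4 := S_ge4.
pose top i j := minn S.-1 (D i j) == minn S.-1 (minn S.-1 (D i j)).+1.
have topE i j : top i j = ~~ (D i j < S.-1) by rewrite /top; lia.
pose E (i j : 'I_n) := upd (upd (upd (upd env 50 0) 1 i) 50 0) 2 j.
pose R := Or (Not (Eq (Dv 1 2) (Dv 2 1)))
  (Or (Not (Eq (Eq (Dv 1 2) Zero) (Eq (Var 1) (Var 2))))
  (Or (Exn 5 (Lt (Add (Dv 1 5) (Dv 5 2)) (Dv 1 2)))
      (And (Lt (num 3) (Dv 1 2)) (Not (between_e 1 2))))).
have -> : bv M env bad_e = [exists i, exists j, top i j || bv M (E i j) R].
  apply: (bv_Exn S4 nS e0) => // i; apply: (bv_Exn S4 nS) => // j.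
  rewrite bv_Or //; congr (_ || _).
  by rewrite bv_Eq // -[ev M _ (Succ _)]/(minn S.-1 (ev M _ (Dv 1 2)).+1) (@ev_Dv _ _ _ _ i j).
(* A saturated entry already satisfies the first disjunct; in its absence all remaining evaluations
   are exact. *)
have [/'forall_forallP small|/forallPn[i /forallPn[j Dij]]] :=
    boolP [forall i, forall j, D i j < S.-1]; last first.
  split=> [/existsPn/(_ i)/existsPn/(_ j)|[/(_ i j)]]; last by rewrite (negbTE Dij).
  by rewrite topE Dij.
have RE i j : bv M (E i j) R = [|| D i j != D j i, (D i j == 0) != (i == j),
    [exists k, D i k + D k j < D i j] | (3 < D i j) && ~~ between D i j].
  have ij := @ev_Dv_exact small M Mx (E i j) 1 2 i j e0 erefl erefl.
  have ji := @ev_Dv_exact small M Mx (E i j) 2 1 j i e0 erefl erefl.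
  rewrite !bv_Or // bv_And // !bv_Not // bv_Eq // ij ji.
  rewrite (bv_between small Mx (a := i) (b := j)) // bv_Lt // ev_num // ij.
  congr [|| _, _, _ | _].
  + have e1 : ev M (E i j) (Eq (Dv 1 2) Zero) = (D i j == 0) by rewrite -ij.
    have e2 : ev M (E i j) (Eq (Var 1) (Var 2)) = (i == j) by rewrite -val_eqE.
    by rewrite bv_Eq // e1 e2; case: (D i j == 0); case: (i == j).
  + apply: (bv_Exn S4 nS) => // k; rewrite bv_Lt // ev_Add.
    rewrite (ev_Dv_exact small Mx (a := i) (b := k)) // (ev_Dv_exact small Mx (a := k) (b := j)) //.
    rewrite (ev_Dv_exact small Mx (a := i) (b := j)) //.
    by have := small i j; lia.
  + have -> : minn S.-1 3 = 3 by lia.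
    by [].
split=> [/existsPn H|[_ [Ds D0 Dt D3]]].
  split=> //.
  have {}H i j : [&& D i j == D j i, (D i j == 0) == (i == j),
      ~~ [exists k, D i k + D k j < D i j] & (3 < D i j) ==> between D i j].
    have /existsPn/(_ j) := H i; rewrite topE small /= RE !negb_or !negbK.
    by rewrite implybE -[between D i j]negbK -negb_and negbK.
  split=> [i j|i j|i j k|i j]; have /and4P[h1 h2 h3 h4] := H i j.
  - exact: (eqP h1).
  - exact: (eqP h2).
  - by rewrite leqNgt; move/existsPn: h3; apply.
  - exact/implyP.
apply/existsPn => i; apply/existsPn => j.
rewrite topE small /= RE Ds eqxx -Ds D0 eqxx /= negb_or; apply/andP; split.
  by apply/existsPn => k; rewrite -leqNgt.
by rewrite negb_and negbK -implybE; apply/implyP; apply: D3.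
Qed.
End MatrixEval.

(** * Solving the 2-SAT instance on the tape *)

(* Tracks 0 and 1 hold the input; each family of four tracks holds a set of
   literals, indexed by the terminals. *)
Definition trk (f : nat) (g s : bool) : nat := 2 + 4 * f + 2 * g + s.

Definition each_kind (c : bool -> bool -> cmd) : cmd :=
  Seq (c false false) (Seq (c false true) (Seq (c true false) (c true true))).

Definition set_family (f : nat) (e : bool -> bool -> expr) : cmd :=
  For 3 (each_kind (fun g s => Wr (trk f g s) (Var 3) (e g s))).

Definition copy_family (f f' : nat) : cmd :=
  set_family f (fun g s => Mem (trk f' g s) (Var 3)).

(** The literal [(g, s)] of terminal 3 follows from its clause with the literal [(h, s)] of terminal
    4 once the opposite of the latter is in the set. *)
Definition derived_e (g s h : bool) : expr :=
  Exn 4 (And (Mem (trk 1 h (~~ s)) (Var 4)) (clause_e s h 4 g 3)).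

(** Family 0 holds the literals decided so far, family 1 the current trial. The new set is assembled
    in family 2, so that family 1 is read unchanged throughout the round and the result is exactly
    [unit_step]. *)
Definition step_c : cmd :=
  Seq (set_family 2 (fun g s => Or (Mem (trk 1 g s) (Var 3))
         (And (Lt (Var 3) (Var 0)) (Or (derived_e g s false) (derived_e g s true)))))
      (copy_family 1 2).

Definition close_c : cmd := For 7 step_c.

Definition clash_e (f : nat) : expr :=
  Exn 4 (Or (And (Mem (trk f false true) (Var 4)) (Mem (trk f false false) (Var 4)))
            (And (Mem (trk f true true) (Var 4)) (Mem (trk f true false) (Var 4)))).

Definition assume_c (g s : bool) : cmd :=
  Seq (copy_family 1 0) (Seq (Wr (trk 1 g s) (Var 8) (num 1)) close_c).

Definition try_c (g : bool) : cmd :=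
  Seq (assume_c g true)
    (Seq (If (clash_e 1) (assume_c g false) Skip) (copy_family 0 1)).

Definition solve_c : cmd :=
  For 8 (If (Lt (Var 8) (Var 0)) (Seq (try_c false) (try_c true)) Skip).

Definition in_family (f t : nat) : bool := 2 + 4 * f <= t < 6 + 4 * f.

Lemma in_family_trk f g s : in_family f (trk f g s).
Proof. by rewrite /in_family /trk; case: g; case: s => /=; lia. Qed.

Lemma in_family_trk_neq f f' g s : f != f' -> ~~ in_family f (trk f' g s).
Proof. by rewrite /in_family /trk; case: g; case: s => /=; lia. Qed.

Lemma trk_inj f g s g' s' : trk f g s = trk f g' s' -> (g, s) = (g', s').
Proof. by rewrite /trk; case: g; case: s; case: g'; case: s' => //=; lia. Qed.

Definition same_off (f : nat) (M M' : memory) : Prop :=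
  forall t, ~~ in_family f t -> M' t =1 M t.

Lemma run_Seq S env c1 c2 st : run S env (Seq c1 c2) st = run S env c2 (run S env c1 st).
Proof. by []. Qed.

Lemma run_If S env b c1 c2 st :
  run S env (If b c1 c2) st = if bv S st.1 env b then run S env c1 st else run S env c2 st.
Proof. by []. Qed.

Lemma run_For S env y c st :
  run S env (For y c) st = foldl (fun st p => run S (upd env y p) c st) st (iota 0 S).
Proof. by []. Qed.

(** Family [f] is overwritten while the expressions are being evaluated, so their values must be the
    same on all memories that agree with [M] outside this family. *)
Lemma set_family_run S env f e (M : memory) O (v : bool -> bool -> nat -> bool) :
  (forall M' g s p, same_off f M M' -> p < S -> bv S M' (upd env 3 p) (e g s) = v g s p) ->
  exists M', [/\ run S env (set_family f e) (M, O) = (M', O), same_off f M M'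
    & forall g s p, p < S -> M' (trk f g s) p = v g s p].
Proof.
move=> ev_e; pose c := each_kind (fun g s => Wr (trk f g s) (Var 3) (e g s)).
suff H j : j <= S -> exists M', [/\
    foldl (fun st p => run S (upd env 3 p) c st) (M, O) (iota 0 j) = (M', O), same_off f M M'
    & forall g s p, p < j -> M' (trk f g s) p = v g s p].
  by have [M' [r so vE]] := H S (leqnn _); exists M'.
elim: j => [_|j IH jS]; first by exists M.
have [M' [r so vE]] := IH (ltnW jS).
pose wr1 (M1 : memory) g s : memory :=
  upd M1 (trk f g s) (upd (M1 (trk f g s)) j (v g s j)).
have w (M1 : memory) g s : same_off f M M1 ->
    run S (upd env 3 j) (Wr (trk f g s) (Var 3) (e g s)) (M1, O) = (wr1 M1 g s, O).
  by move=> so1; rewrite /= -/(bv S M1 (upd env 3 j) (e g s)) ev_e.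
have so_wr1 (M1 : memory) g s : same_off f M M1 -> same_off f M (wr1 M1 g s).
  move=> so1 t tf p; rewrite /wr1 upd_neq ?so1 //; apply/eqP => E.
  by move: tf; rewrite E in_family_trk.
have wr1E M1 g s g' s' p : wr1 M1 g s (trk f g' s') p =
    if ((g', s') == (g, s)) && (p == j) then v g s j else M1 (trk f g' s') p.
  rewrite /wr1 /upd; case: (eqVneq (g', s') (g, s)) => [[-> ->]|ne]; first by rewrite eqxx.
  by rewrite ifN //; apply: contra ne => /eqP/trk_inj ->.
exists (wr1 (wr1 (wr1 (wr1 M' false false) false true) true false) true true); split.
- rewrite -[j.+1]addn1 iotaD foldl_cat r.
  transitivity (run S (upd env 3 j) c (M', O)) => //.
  rewrite /c /each_kind !run_Seq w // w; last exact: so_wr1.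
  rewrite w; last by do 2!apply: (so_wr1).
  by rewrite w //; do 3!apply: (so_wr1).
- by do 4!apply: (so_wr1).
- move=> g s p; rewrite ltnS leq_eqVlt => /orP[/eqP->|pj].
    by rewrite !wr1E eqxx; case: g; case: s.
  by rewrite !wr1E (ltn_eqF pj) !andbF vE.
Qed.

Section Solve.
Variables (n : nat) (D : 'I_n -> 'I_n -> nat).
Let x := enc_matrix D.
Let S := size x + 4.
Hypothesis Dok : admissible D.
Hypothesis Dsmall : forall i j, D i j < S.-1.

Local Notation lits := {set lit n}.
Local Notation ustep := (unit_step (@lneg n) (lclause D)).
Local Notation run := (run S).
Local Notation bv := (bv S).

Definition represents (f : nat) (M : memory) (X : lits) : Prop :=
  forall g s (i : 'I_n), M (trk f g s) i = ((g, s, i) \in X).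

Definition holds (M : memory) (X Z : lits) : Prop :=
  [/\ holds_input x M, represents 0 M X & represents 1 M Z].

Lemma same_off_input f M M' : same_off f M M' -> holds_input x M -> holds_input x M'.
Proof. by move=> so Mx p; have [<- <-] := Mx p; rewrite !so. Qed.

Lemma same_off_represents f f' M M' X :
  same_off f M M' -> f != f' -> represents f' M X -> represents f' M' X.
Proof. by move=> so ff r g s i; rewrite so ?r // in_family_trk_neq. Qed.

Lemma ord_lt_S (i : 'I_n) : i < S.
Proof. have := ltn_ord i; have := @n_lt_S n D; rewrite -/x -/S; lia. Qed.

Lemma copy_family_run env f f' M O X : f != f' -> represents f' M X ->
  exists M', [/\ run env (copy_family f f') (M, O) = (M', O), same_off f M M' & represents f M' X].
Proof.
move=> ff r.
have [|M' [rE so vE]] := @set_family_run S env f (fun g s => Mem (trk f' g s) (Var 3)) M O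
   (fun g s p => M (trk f' g s) p).
  by move=> M' g s p so pS; rewrite bv_Mem /= so // in_family_trk_neq.
by exists M'; split=> // g s i; rewrite vE ?r // ord_lt_S.
Qed.

Lemma step_run env M O X Z : env 0 = n -> holds M X Z ->
  exists2 M', run env step_c (M, O) = (M', O) & holds M' X (ustep Z).
Proof.
move=> e0 [Mx MX MZ]; have S4 := @S_ge4 n D; rewrite -/x -/S in S4.
pose v g s p := M (trk 1 g s) p || (if insub p is Some i then (g, s, i) \in ustep Z else false).
pose e (g s : bool) := Or (Mem (trk 1 g s) (Var 3))
         (And (Lt (Var 3) (Var 0)) (Or (derived_e g s false) (derived_e g s true))).
have derE (M' : memory) g s h (i : 'I_n) : same_off 2 M M' ->
    bv M' (upd env 3 i) (derived_e g s h) = [exists j, ((h, ~~ s, j) \in Z) && clause D s h j g i].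
  move=> so; apply: (bv_Exn S4 (nS D)) => // j.
  rewrite bv_And // bv_Mem /= so ?in_family_trk_neq // MZ; congr (_ && _).
  by apply: (bv_clause Dsmall (same_off_input so Mx)).
have [|M1 [r1 so1 vE]] := @set_family_run S env 2 e M O v.
  move=> M' g s p so pS; rewrite bv_Or // bv_Mem bv_And // bv_Lt /v.
  rewrite !ev_Var upd_eq upd_neq // e0 so ?in_family_trk_neq //.
  case: insubP => [i _ <-|/negbTE->//]; rewrite ltn_ord /= bv_Or // !derE // MZ !inE.
  case: (_ \in Z) => //=; apply/orP/existsP.
    by move=> [/existsP[j /andP[jZ c]]|/existsP[j /andP[jZ c]]];
      [exists (false, ~~ s, j) | exists (true, ~~ s, j)]; rewrite jZ /lclause /= negbK eqxx.
  move=> [[[h t] j] /andP[jZ]]; rewrite /lclause /= => /andP[/eqP tE c].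
  rewrite tE in c; have tE' : t = ~~ s by rewrite -tE negbK.
  rewrite tE' in jZ.
  by case: h jZ c => jZ c; [right|left]; apply/existsP; exists j; rewrite jZ c.
have Z1 : represents 2 M1 (ustep Z).
  move=> g s i; rewrite vE ?ord_lt_S // /v valK MZ.
  by case E: (_ \in Z) => //=; rewrite inE E.
have [M2 [r2 so2 Z2]] := @copy_family_run env 1 2 M1 O _ isT Z1.
exists M2; first by rewrite /step_c run_Seq r1.
split=> //; first by apply: same_off_input so2 (same_off_input so1 Mx).
by apply: (same_off_represents so2) => //; apply: (same_off_represents so1).
Qed.

Lemma close_run env M O X Z : env 0 = n -> holds M X Z ->
  exists2 M', run env close_c (M, O) = (M', O) & holds M' X (iter S ustep Z).
Proof.
move=> e0 H; rewrite /close_c run_For.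
suff G j : exists2 M',
    foldl (fun st p => run (upd env 7 p) step_c st) (M, O) (iota 0 j) = (M', O)
    & holds M' X (iter j ustep Z) by exact: (G S).
elim: j => [|j [M1 r1 H1]]; first by exists M.
have [|M2 r2 H2] := @step_run (upd env 7 j) M1 O X _ _ H1; first by rewrite upd_neq.
by exists M2 => //; rewrite -[j.+1]addn1 iotaD foldl_cat r1.
Qed.

Lemma assume_run env g s (v : 'I_n) M O X Z : env 0 = n -> env 8 = v -> holds M X Z ->
  exists2 M', run env (assume_c g s) (M, O) = (M', O)
    & holds M' X (iter S ustep ((g, s, v) |: X)).
Proof.
move=> e0 e8 [Mx MX MZ].
have [M1 [r1 so1 H1]] := @copy_family_run env 1 0 M O X isT MX.
pose M2 := upd M1 (trk 1 g s) (upd (M1 (trk 1 g s)) v true).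
have r2 : run env (Wr (trk 1 g s) (Var 8) (num 1)) (M1, O) = (M2, O).
  rewrite -[LHS]/(upd M1 (trk 1 g s) (upd (M1 (trk 1 g s)) (env 8) (ev S M1 env (num 1) != 0)), O).
  by rewrite e8 ev_num ?S_ge4 // /M2; congr (upd _ _ (upd _ _ _), _); rewrite /S; lia.
have H2 : holds M2 X ((g, s, v) |: X).
  have so2 : same_off 1 M1 M2.
    move=> t tf p; rewrite /M2 upd_neq //; apply/eqP => E.
    by move: tf; rewrite E in_family_trk.
  split; first exact: same_off_input so2 (same_off_input so1 Mx).
    by apply: (same_off_represents so2) => //; apply: (same_off_represents so1).
  move=> g' s' i; rewrite !inE -H1 /M2 /upd.
  case: (eqVneq (g', s') (g, s)) => [[-> ->]|ne].
    rewrite eqxx xpair_eqE eqxx /= val_eqE; by case: eqP.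
  have tne : trk 1 g' s' != trk 1 g s by apply: contra ne => /eqP/trk_inj ->.
  by rewrite (negbTE tne) xpair_eqE (negbTE ne).
have [M3 r3 H3] := close_run O e0 H2.
by exists M3 => //; rewrite /assume_c !run_Seq r1 r2 r3.
Qed.

Lemma bv_clash env f M X : env 0 = n -> represents f M X ->
  bv M env (clash_e f) = ~~ consistent (@lneg n) X.
Proof.
move=> e0 MX; have S4 := @S_ge4 n D; rewrite -/x -/S in S4.
rewrite (bv_Exn S4 (nS D) (Q := fun i => [exists g, ((g, true, i) \in X) && ((g, false, i) \in X)])) //.
  apply/existsP/forallPn.
    by move=> [i /existsP[g h]]; exists (g, true, i); rewrite negbK.
  move=> [[[g s] i]]; rewrite negbK /lneg /= => h; exists i; apply/existsP; exists g.
  by case: s h => //=; rewrite andbC.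
move=> i; rewrite bv_Or // !bv_And // !bv_Mem !ev_Var upd_eq !MX.
apply/orP/existsP => [[h|h]|[[] h]]; by [exists false | exists true | right | left].
Qed.

Lemma try_run env g (v : 'I_n) M O X Z : env 0 = n -> env 8 = v -> holds M X Z ->
  exists M' Z', run env (try_c g) (M, O) = (M', O) /\
    holds M' (try_lit (@lneg n) (lclause D) S X (g, true, v)) Z'.
Proof.
move=> e0 e8 H.
have [M1 r1 H1] := @assume_run env g true v M O X Z e0 e8 H.
have [M2 r2 H2] : exists2 M2, run env (If (clash_e 1) (assume_c g false) Skip) (M1, O) = (M2, O)
    & holds M2 X (try_lit (@lneg n) (lclause D) S X (g, true, v)).
  have [_ _ c1] := H1; rewrite run_If (bv_clash e0 c1) /try_lit.
  case: ifP => [/negbTE->|/negbFE->]; last by exists M1.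
  exact: (@assume_run env g false v M1 O X _ e0 e8 H1).
have [Mx2 MX2 MZ2] := H2.
have [M3 [r3 so3 H3]] := @copy_family_run env 0 1 M2 O _ isT MZ2.
exists M3, (try_lit (@lneg n) (lclause D) S X (g, true, v)); split.
  by rewrite /try_c run_Seq r1 run_Seq r2 r3.
split=> //; first exact: same_off_input so3 Mx2.
exact: same_off_represents so3 _ MZ2.
Qed.

Definition decisions : seq (lit n) :=
  flatten [seq [:: (false, true, i); (true, true, i)] | i <- enum 'I_n].

Lemma decisions_total l : (l \in decisions) || (lneg l \in decisions).
Proof.
have H g (i : 'I_n) : (g, true, i) \in decisions.
  apply/flattenP; exists [:: (false, true, i); (true, true, i)].
    by apply/mapP; exists i; rewrite ?mem_enum.
  by rewrite !inE; case: g; rewrite !eqxx ?orbT.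
by case: l => [[g []] i]; rewrite /lneg /= H ?orbT.
Qed.

Lemma solve_run env M O : env 0 = n -> holds M set0 set0 ->
  exists M' Z, run env solve_c (M, O) = (M', O) /\
    holds M' (two_sat (@lneg n) (lclause D) S decisions) Z.
Proof.
move=> e0 H; rewrite /solve_c run_For.
have nS' : n <= S by have := @n_lt_S n D; rewrite -/x -/S; lia.
pose f (st : memory * seq sym) p := run (upd env 8 p)
  (If (Lt (Var 8) (Var 0)) (Seq (try_c false) (try_c true)) Skip) st.
rewrite -[foldl _ _ _]/(foldl f (M, O) (iota 0 S)).
have skip1 st p : n <= p -> f st p = st.
  by move=> np; rewrite /f run_If bv_Lt !ev_Var upd_eq upd_neq // e0 ltnNge np.
have skip st s : all (fun p => n <= p) s -> foldl f st s = st.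
  by elim: s => [//|p s IH] /andP[np ns]; rewrite -[LHS]/(foldl f (f st p) s) skip1 // IH.
have iE : iota 0 S = iota 0 n ++ iota n (S - n) by rewrite -iotaD subnKC.
rewrite iE foldl_cat [foldl f _ (iota n _)]skip; last first.
  by apply/allP => p; rewrite mem_iota => /andP[].
rewrite -val_enum_ord /two_sat /decisions.
suff G s M1 X Z : holds M1 X Z -> exists M' Z', foldl f (M1, O) [seq val i | i <- s] = (M', O) /\
    holds M' (foldl (try_lit (@lneg n) (lclause D) S) X
      (flatten [seq [:: (false, true, i); (true, true, i)] | i <- s])) Z'.
  exact: (G _ _ _ _ H).
elim: s M1 X Z => [|i s IH] M1 X Z H1; first by exists M1, Z.
have e0' : upd env 8 i 0 = n by rewrite upd_neq.
have [M2 [Z2 [r2 H2]]] := @try_run (upd env 8 i) false i M1 O X Z e0' (upd_eq _ _ _) H1.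
have [M3 [Z3 [r3 H3]]] := @try_run (upd env 8 i) true i M2 O _ Z2 e0' (upd_eq _ _ _) H2.
have fi : f (M1, O) i = (M3, O).
  by rewrite /f run_If bv_Lt !ev_Var e0' upd_eq ltn_ord run_Seq r2 r3.
rewrite map_cons -[foldl f _ _]/(foldl f (f (M1, O) i) [seq val k | k <- s]) fi.
exact: IH H3.
Qed.
End Solve.

(** * Writing the output *)

Definition bit_c (e : expr) : cmd := If e (Emit Defs.S1) (Emit S0).

(** Division by search: the number whose double, or double plus one, is the given value. *)
Definition half_e : expr :=
  Fold 16 17 Zero (Ite (Or (Eq (Add (Var 17) (Var 17)) (Var 14))
                           (Eq (Succ (Add (Var 17) (Var 17))) (Var 14))) (Var 17) (Var 16)).
Definition shift_e (e : expr) : expr :=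
  Fold 14 15 e (Ite (Lt (Var 15) (Var 13)) half_e (Var 14)).
Definition odd_e (e : expr) : expr :=
  Let 18 e (Ex 19 (Eq (Succ (Add (Var 19) (Var 19))) (Var 18))).
(** Bit number 13 (the loop variable) is written only while the shifted value is nonzero, which
    suppresses leading zeros as in [bin]. *)
Definition bin_c (e : expr) : cmd := For 13 (If (shift_e e) (bit_c (odd_e (shift_e e))) Skip).

Definition order_e : expr := Add (Var 0) (num 2).
Definition hub_mem_e (w i : nat) : expr :=
  Ite (Eq (Var w) (Var 0)) (Mem (trk 0 false true) (Var i)) (Mem (trk 0 true true) (Var i)).
Definition adj_e : expr :=
  Ite (Lt (Var 10) (Var 0))
    (Ite (Lt (Var 11) (Var 0)) (Eq (Dv 10 11) (num 1)) (hub_mem_e 11 10))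
    (Ite (Lt (Var 11) (Var 0)) (hub_mem_e 10 11)
         (And hub_edge_e (Not (Eq (Var 10) (Var 11))))).

Definition below (y : nat) (lim : expr) (c : cmd) : cmd := For y (If (Lt (Var y) lim) c Skip).

Definition output_c : cmd :=
  Seq (bin_c order_e) (Seq (Emit Sep)
  (Seq (below 10 order_e (below 11 order_e (bit_c adj_e))) (Seq (Emit Sep)
  (below 10 (Var 0) (Seq (bin_c (Var 10)) (Emit Sep)))))).

(** The loop tries every candidate for [n]. The body runs in the round that finds it, so that
    variable 0 holds [n] throughout. *)
Definition program (yes : cmd) : cmd :=
  For 0 (If (Eq (Mul (Var 0) (Var 0)) seps)
    (If bad_e (Emit S0) (Seq solve_c (If (clash_e 0) (Emit S0) yes))) Skip).

(** * Words written by commands *)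

Section Emission.
Variable S : nat.
Hypothesis S4 : 4 <= S.

Definition emits (env : nat -> nat) (c : cmd) (M : memory) (w : seq sym) : Prop :=
  forall O, run S env c (M, O) = (M, O ++ w).

Lemma emits_Emit env a M : emits env (Emit a) M [:: a].
Proof. by move=> O; rewrite cats1. Qed.

Lemma emits_Skip env M : emits env Skip M [::].
Proof. by move=> O; rewrite cats0. Qed.

Lemma emits_Seq env c1 c2 M w1 w2 :
  emits env c1 M w1 -> emits env c2 M w2 -> emits env (Seq c1 c2) M (w1 ++ w2).
Proof. by move=> h1 h2 O; rewrite run_Seq h1 h2 catA. Qed.

Lemma emits_If env b c1 c2 M w1 w2 : emits env c1 M w1 -> emits env c2 M w2 ->
  emits env (If b c1 c2) M (if bv S M env b then w1 else w2).
Proof. by move=> h1 h2 O; rewrite run_If; case: ifP. Qed.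

Lemma emits_bit env b M : emits env (bit_c b) M [:: if bv S M env b then Defs.S1 else S0].
Proof.
have := emits_If b (emits_Emit env Defs.S1 M) (emits_Emit env S0 M).
by rewrite /bit_c; case: ifP.
Qed.

Lemma emits_For env y c M (w : nat -> seq sym) :
  (forall p, p < S -> emits (upd env y p) c M (w p)) ->
  emits env (For y c) M (flatten [seq w p | p <- iota 0 S]).
Proof.
move=> H O; pose f (st : memory * seq sym) p := run S (upd env y p) c st.
rewrite run_For -[foldl _ _ _]/(foldl f (M, O) (iota 0 S)).
have {}H p : p \in iota 0 S -> emits (upd env y p) c M (w p).
  by rewrite mem_iota => /andP[_]; apply: H.
elim: (iota 0 S) O H => [|p s IH] O H; first by rewrite cats0.
have fp : f (M, O) p = (M, O ++ w p) by apply: H; rewrite mem_head.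
rewrite -[foldl f _ _]/(foldl f (f (M, O) p) s) fp IH; first by rewrite -catA.
by move=> q qs; apply: H; rewrite inE qs orbT.
Qed.

Lemma emits_below N env y lim c M (w : 'I_N -> seq sym) : N <= S ->
  (forall p, ev S M (upd env y p) lim = N) ->
  (forall u : 'I_N, emits (upd env y u) c M (w u)) ->
  emits env (below y lim c) M (flatten [seq w u | u <- enum 'I_N]).
Proof.
move=> NS limE wE.
pose v p := if insub p is Some u then w u else [::].
have -> : [seq w u | u <- enum 'I_N] = [seq v p | p <- iota 0 N].
  by rewrite -val_enum_ord -map_comp; apply: eq_map => u; rewrite /v /= valK.
have -> : flatten [seq v p | p <- iota 0 N] = flatten [seq v p | p <- iota 0 S].
  rewrite -[in RHS](subnKC NS) iotaD map_cat flatten_cat -[LHS]cats0; congr (_ ++ _).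
  have : all (fun p => N <= p) (iota (0 + N) (S - N)).
    by apply/allP => p; rewrite mem_iota => /andP[].
  elim: iota => //= p s IH /andP[Np Ns]; rewrite -IH // cats0 /v insubN // -leqNgt //.
apply: emits_For => p pS O.
rewrite run_If bv_Lt limE ev_Var upd_eq /v.
by case: insubP => [u pN <-|/negbTE->]; rewrite ?ltn_ord ?cats0 //; apply: wE.
Qed.

Lemma foldl_select (P : nat -> bool) h0 v : h0 < S -> (forall h, h < S -> P h = (h == h0)) ->
  foldl (fun a h => if P h then h else a) v (iota 0 S) = h0.
Proof.
move=> h0S PE.
have H j : j <= S -> foldl (fun a h => if P h then h else a) v (iota 0 j) =
    if h0 < j then h0 else v.
  elim: j => // j IH jS; rewrite -[j.+1]addn1 iotaD foldl_cat (IH (ltnW jS)) /= PE // addn1 ltnS.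
  by case: (ltngtP h0 j) => // ->.
by rewrite H // h0S.
Qed.

Lemma ev_half M env : env 14 < S.-1 -> ev S M env half_e = (env 14)./2.
Proof.
move=> yS; rewrite /half_e ev_Fold.
pose P h := (minn S.-1 (h + h) == env 14) || (minn S.-1 (minn S.-1 (h + h)).+1 == env 14).
rewrite (@eq_in_foldl _ _ _ (fun a h => if P h then h else a)); last first.
  by move=> a h _; rewrite ev_Ite bv_Or // !bv_Eq.
have yE := odd_double_half (env 14); rewrite -muln2 in yE.
apply: foldl_select => [|h hS]; first by lia.
by rewrite /P; case: (odd _) yE => /= yE; lia.
Qed.

Lemma iter_half_le k v : iter k half v <= v.
Proof. by elim: k => //= k IH; have := odd_double_half (iter k half v); rewrite -muln2; lia. Qed.

Lemma ev_shift M env e : ev S M env e < S.-1 -> env 13 < S ->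
  ev S M env (shift_e e) = iter (env 13) half (ev S M env e).
Proof.
move=> vS kS; rewrite /shift_e ev_Fold; set v := ev S M env e in vS *.
have H j : j <= S ->
    foldl (fun a p => ev S M (upd (upd env 14 a) 15 p)
      (Ite (Lt (Var 15) (Var 13)) half_e (Var 14))) v (iota 0 j) = iter (minn j (env 13)) half v.
  elim: j => [|j IH] jS; first by rewrite min0n.
  rewrite -[j.+1]addn1 iotaD foldl_cat (IH (ltnW jS)).
  set a := iter _ _ _.
  have aS : a < S.-1 by apply: leq_ltn_trans (iter_half_le _ _) vS.
  rewrite -[LHS]/(ev S M (upd (upd env 14 a) 15 j) (Ite (Lt (Var 15) (Var 13)) half_e (Var 14))).
  rewrite ev_Ite bv_Lt !ev_Var [upd _ 15 j 15]upd_eq ev_half //.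
  rewrite -[upd (upd env 14 a) 15 j 14]/a -[upd (upd env 14 a) 15 j 13]/(env 13) addn1.
  case: ltnP => jk.
    by have -> : minn j.+1 (env 13) = (minn j (env 13)).+1 by lia.
  by have -> : minn j.+1 (env 13) = minn j (env 13) by lia.
by rewrite H //; have -> : minn S (env 13) = env 13 by lia.
Qed.

Lemma bv_odd M env e : ev S M env e < S.-1 -> bv S M env (odd_e e) = odd (ev S M env e).
Proof.
move=> vS; rewrite /odd_e /bv ev_Let -/(bv S M _ _) bv_Ex //; set v := ev S M env e in vS *.
have vE := odd_double_half v; rewrite -muln2 in vE.
apply/hasP/idP => [[h _]|ov].
  rewrite bv_Eq -[ev S M _ (Succ _)]/(minn S.-1 (minn S.-1 (h + h)).+1).
  rewrite -[ev S M _ (Var 18)]/v => /eqP hE.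
  by case: (odd v) vE => // vE; lia.
exists v./2; first by rewrite mem_iota; lia.
rewrite bv_Eq -[ev S M _ (Succ _)]/(minn S.-1 (minn S.-1 (v./2 + v./2)).+1).
by rewrite -[ev S M _ (Var 18)]/v; rewrite ov in vE; apply/eqP; lia.
Qed.

(** Halving reaches zero within [v] rounds, so any number of rounds and any fuel not below [v] yield
    the same word. *)
Lemma bits_bin f f' v : v <= f -> v <= f' ->
  flatten [seq (if iter k half v != 0 then [:: if odd (iter k half v) then Defs.S1 else S0]
                else [::]) | k <- iota 0 f] = bin_fuel f' v.
Proof.
have zero s : flatten [seq (if iter k half 0 != 0
    then [:: if odd (iter k half 0) then Defs.S1 else S0] else [::]) | k <- s] = [::].
  have z k : iter k half 0 = 0 by elim: k => //= k ->.
  by elim: s => //= k s ->; rewrite z.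
have [->|v0] := eqVneq v 0; first by rewrite zero; case: f'.
elim: f f' v v0 => [|f IH] [|f'] v v0 vf vf'; try by lia.
rewrite -[iota 0 f.+1]/(0 :: iota (1 + 0) f) iotaDl map_cons -map_comp.
have -> : [seq ((fun k => if iter k half v != 0
     then [:: if odd (iter k half v) then Defs.S1 else S0] else [::]) \o addn 1) i | i <- iota 0 f] =
   [seq (if iter k half v./2 != 0 then [:: if odd (iter k half v./2) then Defs.S1 else S0]
                else [::]) | k <- iota 0 f].
  apply: eq_map => k; rewrite -[LHS]/(if iter k.+1 half v != 0
     then [:: if odd (iter k.+1 half v) then Defs.S1 else S0] else [::]).
  by rewrite iterSr.
have vE := odd_double_half v; rewrite -muln2 in vE.
rewrite [RHS]/= [iter 0 half v]/= (negbTE v0) [flatten _]/=; congr (_ :: _).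
have [v2|v2] := eqVneq v./2 0; last by apply: IH => //; lia.
by rewrite v2 zero; case: (f').
Qed.

Lemma emits_bin env e M : (forall p, ev S M (upd env 13 p) e = ev S M env e) ->
  ev S M env e < S.-1 -> emits env (bin_c e) M (bin (ev S M env e)).
Proof.
move=> eE vS; rewrite /bin -(@bits_bin S) //; last by lia.
apply: emits_For => p pS.
have sE : ev S M (upd env 13 p) (shift_e e) = iter p half (ev S M env e).
  by rewrite ev_shift ?eE // upd_eq.
have := emits_If (shift_e e) (emits_bit (upd env 13 p) (odd_e (shift_e e)) M)
  (emits_Skip (upd env 13 p) M).
rewrite bv_odd sE; last by apply: leq_ltn_trans (iter_half_le _ _) vS.
by rewrite /bv sE.
Qed.
End Emission.

(** * Correctness of the whole program *)

Section Program.
Variables (n : nat) (D : 'I_n -> 'I_n -> nat).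
Let x := enc_matrix D.
Let S := size x + 4.
Local Notation ev := (ev S).
Local Notation bv := (bv S).

Definition joined (X : {set lit n}) (g : bool) (i : 'I_n) : bool := (g, true, i) \in X.

Lemma S4 : 4 <= S. Proof. exact: S_ge4. Qed.

Lemma nS4 : n + 4 <= S. Proof. exact: n_lt_S. Qed.

Section Output.
Hypothesis Dsmall : forall i j, D i j < S.-1.
Variables (M : memory) (X : {set lit n}).
Hypothesis Mx : holds_input x M.
Hypothesis MX : represents 0 M X.

Lemma bv_hub_mem env w i (g : bool) (a : 'I_n) :
  env 0 = n -> env w = n + g -> env i = a -> bv M env (hub_mem_e w i) = joined X g a.
Proof.
move=> e0 ew ei; rewrite bv_Ite bv_Eq !bv_Mem !ev_Var e0 ew ei !MX.
by case: g {ew} => /=; [rewrite ifN //; lia | rewrite addn0 eqxx].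
Qed.

Lemma val_hub g : val (hub n g) = n + g.
Proof. by rewrite /= inordK; case: g. Qed.

Lemma bv_adj env (u v : 'I_(n + 2)) : env 0 = n -> env 10 = u -> env 11 = v ->
  bv M env adj_e = hub_adj D (joined X) u v.
Proof.
have S4 := S4; move=> e0.
have tN (k : 'I_n) : (lshift 2 k < n) = true := ltn_ord k.
have hN (g : bool) : (n + g < n) = false by rewrite ltnNge leq_addr.
have lt y k : env y = k -> bv M env (Lt (Var y) (Var 0)) = (k < n).
  by move=> ey; rewrite bv_Lt !ev_Var e0 ey.
case: (vertexP u) => [i ->|g ->]; case: (vertexP v) => [j ->|h ->];
  rewrite ?val_hub => eu ev; rewrite /adj_e bv_Ite (lt _ _ eu) ?tN ?hN bv_Ite (lt _ _ ev) ?tN ?hN.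
- rewrite adj_term bv_Eq ev_num // (ev_Dv_exact Dsmall Mx (a := i) (b := j)) //.
  by have -> : minn S.-1 1 = 1 by lia.
- by rewrite adj_hub; apply: bv_hub_mem.
- by rewrite hub_adj_term; apply: bv_hub_mem.
- rewrite adj_hubs bv_And bv_Not // bv_Eq !ev_Var eu ev (bv_hub_edge Dsmall Mx e0).
  by rewrite eqn_add2l; case: g {eu}; case: h {ev}.
Qed.

Lemma ev_order env : env 0 = n -> ev M env order_e = n + 2.
Proof. by move=> e0; rewrite ev_Add ev_num ?S4 // ev_Var e0; have := nS4; lia. Qed.

Lemma output_emits env : env 0 = n ->
  emits S env output_c M (enc_realisation (hub_adj D (joined X)) (@lshift n 2)).
Proof.
move=> e0; have S4 := S4; have nS := nS4.
apply: emits_Seq.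
  rewrite -(ev_order e0); apply: emits_bin => //.
  by rewrite (ev_order e0); lia.
apply: emits_Seq; first exact: emits_Emit.
apply: emits_Seq; last (apply: emits_Seq; first exact: emits_Emit).
  rewrite [X in emits _ _ _ _ X](_ : _ = flatten [seq flatten
     [seq [:: if hub_adj D (joined X) u v then Defs.S1 else S0] | v <- enum 'I_(n + 2)]
       | u <- enum 'I_(n + 2)]); last first.
    by congr flatten; apply: eq_map => u; rewrite flatten_map1.
  apply: emits_below; first by lia.
    by move=> p; rewrite ev_order.
  move=> u; apply: emits_below; first by lia.
    by move=> p; rewrite ev_order.
  move=> v; have := @emits_bit S (upd (upd env 10 u) 11 v) adj_e M.
  by rewrite (@bv_adj _ u v).
apply: emits_below; first by lia.
  by move=> p; rewrite ev_Var upd_neq.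
move=> i; apply: emits_Seq; last exact: emits_Emit.
rewrite -[nat_of_ord (lshift 2 i)]/(ev M (upd env 10 i) (Var 10)); apply: emits_bin => //.
by rewrite ev_Var upd_eq; have := ltn_ord i; lia.
Qed.
End Output.

Lemma nth_map_onth (f : sym -> bool) y p :
  nth false (map f y) p = if onth y p is Some a then f a else false.
Proof. by elim: y p => [|a y IH] [|p] /=. Qed.

Definition memory0 : memory := fun m p => sym_bit m (onth x p).

Lemma memory0_input : holds_input x memory0.
Proof. by move=> p; rewrite !nth_map_onth /memory0; case: onth => [[]|]. Qed.

Lemma memory0_holds : holds D memory0 set0 set0.
Proof.
split; first exact: memory0_input; by move=> [] [] i; rewrite inE.
Qed.

(** The product may be capped, but [n * n + 4 <= S] keeps the number of separators below the cap, so
    no wrong candidate passes. *)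
Lemma guardE M env p : holds_input x M ->
  bv M (upd env 0 p) (Eq (Mul (Var 0) (Var 0)) seps) = (p == n).
Proof.
move=> Mx; rewrite bv_Eq (@ev_seps _ S4 x (erefl _) M) // count_sep_matrix.
rewrite -[ev _ _ (Mul _ _)]/(minn S.-1 (p * p)); have nS := sqr_le_size D; rewrite -/x -/S in nS.
apply/eqP/eqP => [E|->]; last by lia.
have {}E : p * p = n * n by lia.
by apply/eqP; rewrite -(@eqn_exp2r _ _ 2) // -!mulnn E.
Qed.

(** Stated for an arbitrary final command [yes], so that one proof serves both the decision and the
    construction of a realisation. *)
Theorem program_correct (yes : cmd) (word : {set lit n} -> seq sym) :
  (forall M X env, (forall i j, D i j < S.-1) -> holds_input x M -> represents 0 M X ->
     env 0 = n -> emits S env yes M (word X)) ->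
  exists X, let out := (run S (fun=> 0) (program yes) (memory0, [::])).2 in
    [/\ admissible D, grouping D (joined X) & out = word X] \/
    (~ CombDMR 2 D /\ out = [:: S0]).
Proof.
move=> yesE; have S4 := S4; have nS := nS4.
pose env0 := upd (fun=> 0) 0 n.
have e0 : env0 0 = n by [].
pose body := If bad_e (Emit S0) (Seq solve_c (If (clash_e 0) (Emit S0) yes)).
have key : exists X M' w, [/\ run S env0 body (memory0, [::]) = (M', w), holds_input x M' &
    [/\ admissible D, grouping D (joined X) & w = word X] \/
    (~ CombDMR 2 D /\ w = [:: S0])].
  have bad := bv_bad memory0_input e0; rewrite /body run_If.
  have small : CombDMR 2 D -> (forall i j, D i j < S.-1) /\ admissible D.
    by move=> /CombDMR2_necessary[ok _ le]; split=> // i j; have := le i j; lia.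
  case: ifP => [b|/negbT/bad[Dsmall Dok]].
    exists set0, memory0, [:: S0]; split=> //; first exact: memory0_input.
    by right; split=> // /small/bad; rewrite b.
  have [M1 [Z [r1 [M1x M1X _]]]] := solve_run Dsmall [::] e0 memory0_holds.
  set X := two_sat _ _ _ _ in M1X.
  have Lk : #|lit n| <= S.
    by rewrite !card_prod !card_bool card_ord; have := lits_le_S D; rewrite -/x -/S; lia.
  rewrite run_Seq r1 run_If (bv_clash D e0 M1X); case: ifP => [bad2|/negbFE cons].
    exists set0, M1, [:: S0]; split=> //; right; split=> //.
    move=> /CombDMR2_necessary[_ [A /grouping_model Am] _].
    move: bad2; rewrite (two_sat_complete (@lnegK n) (lclause_sym Dok) _ Lk Am) //.
  exists X, M1, (word X); split=> //.
    by rewrite (yesE M1 X env0 Dsmall M1x M1X e0 [::]) cat0s.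
  left; split=> //; apply: model_grouping => //.
  apply: (two_sat_sound (@lnegK n)) => //; exact: decisions_total.
have [X [M' [w [r M'x H]]]] := key.
exists X; suff -> : run S (fun=> 0) (program yes) (memory0, [::]) = (M', w) by [].
rewrite /program run_For -/body.
pose f (st : memory * seq sym) p := run S (upd (fun=> 0) 0 p) (If (Eq (Mul (Var 0) (Var 0)) seps) body Skip) st.
rewrite -[foldl _ _ _]/(foldl f (memory0, [::]) (iota 0 S)).
have fn M O : holds_input x M -> f (M, O) n = run S env0 body (M, O).
  by move=> Mx; rewrite /f run_If guardE // eqxx.
(* Rounds after the successful one start from a changed memory, but the input tracks are intact, so
   the guard still rejects every other candidate. *)
have skip M O s : holds_input x M -> n \notin s -> foldl f (M, O) s = (M, O).
  move=> Mx; elim: s => [//|p s IH]; rewrite inE negb_or => /andP[np ns].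
  have fp : f (M, O) p = (M, O) by rewrite /f run_If guardE // eq_sym (negbTE np).
  by rewrite -[LHS]/(foldl f (f (M, O) p) s) fp IH.
have -> : iota 0 S = iota 0 n ++ n :: iota n.+1 (S - n.+1).
  by rewrite -[n :: _]/(iota n (S - n.+1).+1) -iotaD; congr iota; lia.
rewrite foldl_cat skip; [|exact: memory0_input|by rewrite mem_iota /= ltnn].
rewrite -[LHS]/(foldl f (f (memory0, [::]) n) (iota n.+1 (S - n.+1))) fn; last exact: memory0_input.
by rewrite r skip // mem_iota ltnn.
Qed.
End Program.

Theorem mainTheorem4 :
  (* 2-CombDMR is decidable in polynomial time *)
  (exists (M : TM) (c : nat), forall (n : nat) (D : 'I_n -> 'I_n -> nat),
     exists t, t <= c * size (enc_matrix D) ^ c + c /\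
       ((tm_result M (enc_matrix D) t = Some [:: S1] /\ CombDMR 2 D) \/
        (tm_result M (enc_matrix D) t = Some [:: S0] /\ ~ CombDMR 2 D))) /\
  (* on YES-instances a realisation with at most n+2 vertices can be output
     in polynomial time *)
  (exists (M : TM) (c : nat), forall (n : nat) (D : 'I_n -> 'I_n -> nat),
     CombDMR 2 D ->
     exists t, t <= c * size (enc_matrix D) ^ c + c /\
       exists (N : nat) (e : rel 'I_N) (Phi : 'I_n -> 'I_N),
         realisation D e Phi /\ N <= n + 2 /\
         tm_result M (enc_matrix D) t = Some (enc_realisation e Phi)).
Proof.
split.
- have [M [c Mc]] := cmd_poly_time (program (Emit Defs.S1)).
  exists M, c => n D; have [t [tB tr]] := Mc (enc_matrix D); exists t; split=> //.
  have [] := @program_correct n D (Emit Defs.S1) (fun=> [:: Defs.S1]).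
    by move=> *; apply: emits_Emit.
  move=> X [[ok gr oE]|[no oE]]; [left | right]; (split; first by rewrite tr; congr Some) => //.
  by exists (n + 2), (hub_adj D (joined X)), (@lshift n 2); split=> //; apply: hub_realisation.
- have [M [c Mc]] := cmd_poly_time (program output_c).
  exists M, c => n D yes; have [t [tB tr]] := Mc (enc_matrix D); exists t; split=> //.
  have [] := @program_correct n D output_c
    (fun X => enc_realisation (hub_adj D (joined X)) (@lshift n 2)).
    by move=> M' X env Dsmall Mx MX e0; apply: output_emits.
  move=> X [[ok gr oE]|[no _]]; last by case: no.
  exists (n + 2), (hub_adj D (joined X)), (@lshift n 2).
  by split; [exact: hub_realisation | split; [| rewrite tr; congr Some; exact: oE]].
Qed.
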